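(* Let $K$ be a field with at least $13$ elements. Let $S \subset \mathbb{P}^3$ be a smooth cubic surface over $K$. Suppose $S$ contains a pair of skew lines both defined over $K$. Let $P\in S(K)$ be a point on either line that is not an Eckardt point. Then $\mathrm{Span}(P)=S(K)$.
   Context: A $K$-line is a line $\ell \subset \mathbb{P}^3$ defined over $K$. If $\ell \not\subset S$ is a $K$-line, then $\ell\cdot S = P+Q+R$ denotes the intersection of $\ell$ with $S$ counted with multiplicity. For $B \subseteq S(K)$ define $B=B_0\subseteq B_1\subseteq B_2 \subseteq\cdots\subseteq S(K)$ as follows: $B_{n+1}$ is the set of points $R\in S(K)$ such that either $R\in B_n$, or for some $K$-line $\ell\not\subset S$ we have $\ell\cdot S=P+Q+R$ with $P,Q\in B_n$ (with $P=Q$ allowed). Then $\mathrm{Span}(B)=\bigcup_n B_n$, and $\mathrm{Span}(P)$ means $\mathrm{Span}(\{P\})$. An Eckardt point of $S$ is a point where three of the lines (defined over $\overline{K}$) contained in $S$ meet. *)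

(* Defs.v *)
From mathcomp Require Import all_boot all_order all_algebra all_field.
From mathcomp Require Import mpoly.
Set Implicit Arguments.
Unset Strict Implicit.
Unset Printing Implicit Defensive.
Import GRing.Theory.
Local Open Scope ring_scope.

(* Points and lines of P^3 over L are the linear subspaces of L^4 of dimension
   1 and 2; incidence is inclusion of subspaces. *)
Definition is_point (L : fieldType) (X : {vspace 'rV[L]_4}) : bool :=
  \dim X == 1%N.

Definition is_line (L : fieldType) (l : {vspace 'rV[L]_4}) : bool :=
  \dim l == 2%N.

Definition skew_lines (L : fieldType) (l m : {vspace 'rV[L]_4}) : bool :=
  (l :&: m == 0)%VS.

Definition at_least (n : nat) (T : eqType) : Prop :=
  exists s : seq T, uniq s /\ (n <= size s)%N.

Definition vanishes_on (L : fieldType) (F : {mpoly L[4]})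
    (U : {vspace 'rV[L]_4}) : Prop :=
  forall v : 'rV[L]_4, v \in U -> F.@[fun i => v 0 i] = 0.

Definition rational_point (K : fieldType) (F : {mpoly K[4]})
    (X : {vspace 'rV[K]_4}) : Prop :=
  is_point X /\ vanishes_on F X.

(* F (x + t y), as a univariate polynomial in t. *)
Definition param_poly (L : fieldType) (F : {mpoly L[4]}) (x y : 'rV[L]_4) :
    {poly L} :=
  mmap (@polyC L) (fun i => (x 0 i)%:P + (y 0 i)%:P * 'X) F.

(* Multiplicity of the point X in the intersection of the line l with the
   surface F = 0 (for l not contained in the surface): writing X = <x> and
   l = <x, y>, the order of vanishing at t = 0 of F (x + t y).  When F is
   homogeneous this does not depend on the choice of x and y. *)
Definition int_mult (L : fieldType) (F : {mpoly L[4]})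
    (l X : {vspace 'rV[L]_4}) : nat :=
  if (X <= l)%VS then mup 0 (param_poly F (vpick X) (vpick (l :\: X)%VS))
  else 0%N.

Section Geometric.

Variables (K : fieldType) (Kbar : closedFieldType) (iota : {rmorphism K -> Kbar}).
Implicit Types (F : {mpoly K[4]}) (U l P Q R : {vspace 'rV[K]_4}).

Definition is_algebraic_closure : Prop := forall z : Kbar, algebraicOver iota z.

Definition base_change U : {vspace 'rV[Kbar]_4} :=
  <<[seq map_mx iota v | v <- vbasis U]>>%VS.

Definition geom F : {mpoly Kbar[4]} := map_mpoly iota F.

Definition smooth_cubic_surface F : Prop :=
  [/\ F != 0, F \is 3.-homog
    & forall v : 'rV[Kbar]_4, v != 0 -> (geom F).@[fun i => v 0 i] = 0 ->
      exists i : 'I_4, ((geom F)^`M(i)).@[fun j => v 0 j] != 0].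

(* Containment is tested on all points over Kbar, so that it is
   scheme-theoretic even when K is finite. *)
Definition line_in_surface F l : Prop := vanishes_on (geom F) (base_change l).

(* l . S = P + Q + R, as an equality of 0-cycles on P^3 over Kbar. *)
Definition intersection_is F l P Q R : Prop :=
  forall X : {vspace 'rV[Kbar]_4}, is_point X ->
    int_mult (geom F) (base_change l) X =
      ((X == base_change P) + (X == base_change Q) + (X == base_change R))%N.

Definition eckardt_point F P : Prop :=
  exists m1 m2 m3 : {vspace 'rV[Kbar]_4},
    [/\ uniq [:: m1; m2; m3],
        all (@is_line Kbar) [:: m1; m2; m3],
        all (fun m => base_change P <= m)%VS [:: m1; m2; m3]
      & forall m, m \in [:: m1; m2; m3] -> vanishes_on (geom F) m].

Fixpoint span_step F (B : {vspace 'rV[K]_4} -> Prop) (n : nat)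
    (R : {vspace 'rV[K]_4}) : Prop :=
  match n with
  | 0 => B R
  | n'.+1 => rational_point F R /\
      (span_step F B n' R \/
       exists l, [/\ is_line l, ~ line_in_surface F l &
         exists P Q, [/\ span_step F B n' P, span_step F B n' Q
                       & intersection_is F l P Q R]])
  end.

Definition Span F (B : {vspace 'rV[K]_4} -> Prop) (R : {vspace 'rV[K]_4}) : Prop :=
  exists n : nat, span_step F B n R.

End Geometric.

(* Main.v *)
Require Import Defs.
From mathcomp Require Import all_boot all_order all_algebra all_field.
From mathcomp Require Import mpoly ring.
Set Implicit Arguments.
Unset Strict Implicit.
Unset Printing Implicit Defensive.
Import GRing.Theory.
Local Open Scope ring_scope.

(** The surface is the zero locus of a cubic form f, written on vectors of L^4
    together with its polarizations: grad u v is the derivative of f at u in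
    the direction v, and polar is the full polarization. If f u = f v = 0,
    then f (s u + t v) = s t (s grad u v + t grad v u). So the line through u
    and v lies on the surface exactly when both gradients vanish, and otherwise
    its third point is grad v u *: u - grad u v *: v. Hence the span, seen as a
    set S of vectors, is stable under a secant move (u, v in S give the third
    point) and a tangent move (u in S, grad u v = 0 and grad v u != 0 give v,
    since the line uv then meets the surface in 2 u + v). Beyond these
    moves the argument uses two consequences of smoothness: the gradient does
    not vanish at a point of the surface, and no plane is tangent to the
    surface at every point of a line of the surface.

    Let a in S lie on a line l = <a, b> of the surface. The tangent plane
    <a, b, n> at a meets the surface in l and a residual conic through a, and
    if a is not an Eckardt point the conic is smooth at a
    (non_eckardt_smooth_at). Then all of l is in S (line_covered), in two
    cases.
    - The conic is smooth. Tangent moves from a reach all its rational points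
      off l, and its chords then reach every point of l except the conjugate
      of a, the other point of the conic on l (line_covered_off_conjugate).
      To get that one too, start again from another point a' of l, whose conic
      must be smooth and which must avoid the two points of the first conic.
      The singular conics are the zeros of the discriminant, a nonzero quintic
      form on the pencil of planes through l, and each plane is tangent at two
      points of l at most. So 2 + 2 * 5 = 12 points must be avoided, and 13
      field elements suffice (good_point_exists).
    - The conic is singular. As it is smooth at a, it is a pair of rational
      lines, so the plane cuts the surface in a triangle with vertices a, b, n
      for suitable b and n. Tangent moves from a reach the points of the side bn
      other than b and n. At one of these the conic residual to bn is smooth, so
      by the first case all of bn, in particular n, is in S; tangent moves from
      n give l (triangle_line_covered). The discriminant is again nonzero along
      the sides of a triangle, because the plane of the triangle is a simple
      zero.

    Let l' be a line of the surface skew to l. The plane of a smooth conic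
    met above cuts l' in a point w of this conic, so w is in S. If the
    conic residual to l' in the tangent plane at w were singular at w, the line
    from w to the point where this plane cuts l would be on the surface, hence
    part of the smooth conic. So w has on l' the property that a has on l, and
    all of l' is in S (skew_line_covered). Finally a point off l and l' lies on
    exactly one transversal of l and l'. If the transversal is not on the
    surface a secant move ends the proof (surface_covered); if it is, see
    transversal_covered.

    The algebraic closure enters only in deducing the two consequences of
    smoothness, in interpreting Eckardt points, and in checking that the
    moves are intersections of cycles (chord_int_mult). *)

(** * Linear algebra in small dimension *)

Section FreeFamilies.

Variables (L : fieldType) (V : vectType L).
Implicit Types (u v w : V) (x y z t : L).

Lemma mem_span2 u v w :
  reflect (exists x y, w = x *: u + y *: v) (w \in <<[:: u; v]>>%VS).
Proof.
rewrite span_cons span_seq1; apply: (iffP memv_addP) => [[_ /vlineP[x ->]]|].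
  by case=> [_ /vlineP[y ->] ->]; exists x, y.
case=> x [y ->]; exists (x *: u); rewrite ?memvZ ?memv_line //.
by exists (y *: v); rewrite ?memvZ ?memv_line.
Qed.

Lemma mem_span3 u v w r :
  reflect (exists x y z, r = x *: u + y *: v + z *: w)
          (r \in <<[:: u; v; w]>>%VS).
Proof.
rewrite span_cons; apply: (iffP memv_addP) => [[_ /vlineP[x ->]]|].
  by case=> _ /mem_span2[y [z ->]] ->; exists x, y, z; rewrite addrA.
case=> x [y [z ->]]; exists (x *: u); rewrite ?memvZ ?memv_line //.
by exists (y *: v + z *: w); rewrite ?addrA //; apply/mem_span2; exists y, z.
Qed.

Lemma free2P u v :
  reflect (forall x y, x *: u + y *: v = 0 -> x = 0 /\ y = 0) (free [:: u; v]).
Proof.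
apply: (iffP (@freeP _ _ 2 [tuple u; v])) => uv_free.
  move=> x y; move: (uv_free (fun i => [:: x; y]`_i)).
  rewrite !big_ord_recl big_ord0 addr0 /= => uv0 /uv0 k0.
  by move: (k0 0) (k0 1).
move=> k; rewrite !big_ord_recl big_ord0 addr0 /= => /uv_free[k0 k1].
by case=> [[|[|i]] lt_i] //; [rewrite -k0 | rewrite -k1]; congr (k _); apply: val_inj.
Qed.

Lemma free3P u v w :
  reflect (forall x y z, x *: u + y *: v + z *: w = 0 -> [/\ x = 0, y = 0 & z = 0])
          (free [:: u; v; w]).
Proof.
apply: (iffP (@freeP _ _ 3 [tuple u; v; w])) => uvw_free.
  move=> x y z; move: (uvw_free (fun i => [:: x; y; z]`_i)).
  rewrite !big_ord_recl big_ord0 addr0 /= addrA => uvw0 /uvw0 k0.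
  by move: (k0 ord0) (k0 1) (k0 (inord 2)); rewrite inordK.
move=> k; rewrite !big_ord_recl big_ord0 addr0 /= addrA.
case/uvw_free=> k0 k1 k2.
by case=> [[|[|[|i]]] lt_i] //; [rewrite -k0 | rewrite -k1 | rewrite -k2];
  congr (k _); apply: val_inj.
Qed.

Lemma free4P u v w r :
  reflect (forall x y z t, x *: u + y *: v + (z *: w + t *: r) = 0 ->
             [/\ x = 0, y = 0, z = 0 & t = 0]) (free [:: u; v; w; r]).
Proof.
apply: (iffP (@freeP _ _ 4 [tuple u; v; w; r])) => uvwr_free.
  move=> x y z t; move: (uvwr_free (fun i => [:: x; y; z; t]`_i)).
  rewrite !big_ord_recl big_ord0 addr0 /= addrA => comb0 /comb0 k0.
  by move: (k0 ord0) (k0 1) (k0 (inord 2)) (k0 (inord 3)); rewrite !inordK.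
move=> k; rewrite !big_ord_recl big_ord0 addr0 /= addrA.
case/uvwr_free=> k0 k1 k2 k3.
by case=> [[|[|[|[|i]]]] lt_i] //; [rewrite -k0|rewrite -k1|rewrite -k2|rewrite -k3];
  congr (k _); apply: val_inj.
Qed.

End FreeFamilies.

Section Space.

Variable L : fieldType.
Implicit Types (u v w p : 'rV[L]_4) (X l : {vspace 'rV[L]_4}).

Lemma basis4_decomp u v w p r : free [:: u; v; w; p] ->
  exists x y z t, r = x *: u + y *: v + (z *: w + t *: p).
Proof.
move=> uvwp_free; have : r \in <<[:: u; v; w; p]>>%VS.
  suff -> : <<[:: u; v; w; p]>>%VS = fullv by apply: memvf.
  apply/eqP; rewrite eqEdim subvf dimvf dim_matrix.
  by move: uvwp_free; rewrite /free => /eqP->.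
rewrite span_cons => /memv_addP[_ /vlineP[x ->]] [_ /mem_span3[y [z [t ->]]] ->].
by exists x, y, z, t; rewrite !addrA.
Qed.

Lemma skew_free u v w p :
  free [:: u; v] -> free [:: w; p] -> skew_lines <<[:: u; v]>>%VS <<[:: w; p]>>%VS ->
  free [:: u; v; w; p].
Proof.
move=> /free2P uv_free /free2P wp_free /eqP skew; apply/free4P => x y z t comb0.
have : x *: u + y *: v \in (<<[:: u; v]>> :&: <<[:: w; p]>>)%VS.
  rewrite memv_cap; apply/andP; split; apply/mem_span2; first by exists x, y.
  by exists (- z), (- t); rewrite !scaleNr -opprD; apply/eqP; rewrite -addr_eq0 comb0.
rewrite skew memv0 => /eqP uv0; move: comb0; rewrite uv0 add0r.
by have [-> ->] := uv_free _ _ uv0 => /wp_free[-> ->].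
Qed.

Lemma vlineZ k v : k != 0 -> <[k *: v]>%VS = <[v]>%VS.
Proof.
move=> k_neq0; apply/eqP; rewrite eqEsubv -!memvE memvZ ?memv_line //=.
by apply/vlineP; exists k^-1; rewrite scalerA mulVf // scale1r.
Qed.

Lemma span2_complement u v (y z : L) : y *: u + z *: v != 0 ->
  exists y' z', y * z' - z * y' != 0.
Proof.
have [-> uv|y_neq0 _] := eqVneq y 0; last by exists 0, 1; rewrite mulr1 mulr0 subr0.
exists 1, 0; rewrite mul0r mulr1 sub0r oppr_eq0; apply: contra uv => /eqP->.
by rewrite !scale0r addr0.
Qed.

Lemma span2_change_basis u v (y z y' z' s t : L) :
  y * z' - z * y' != 0 ->
  exists p' q' : L, s *: u + t *: v = p' *: (y *: u + z *: v) + q' *: (y' *: u + z' *: v).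
Proof.
move=> det; exists ((s * z' - t * y') / (y * z' - z * y')).
exists ((y * t - z * s) / (y * z' - z * y')).
by apply/rowP => i; rewrite !mxE; field.
Qed.

Lemma vpick_point X : is_point X -> vpick X != 0 /\ X = <[vpick X]>%VS.
Proof.
move=> /eqP dimX; have x_neq0 : vpick X != 0 by rewrite vpick0 -dimv_eq0 dimX.
by split=> //; apply/eqP; rewrite eq_sym eqEdim -memvE memv_pick dim_vline x_neq0 dimX.
Qed.

Lemma vpick_diff l X : is_line l -> is_point X -> (X <= l)%VS ->
  vpick (l :\: X)%VS \in l /\ vpick (l :\: X)%VS \notin X.
Proof.
move=> /eqP dim_l /eqP dimX Xl; set y := vpick _.
have y_lX : y \in (l :\: X)%VS by apply: memv_pick.
split; first by apply: subvP y_lX; apply: diffvSl.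
have y_neq0 : y != 0.
  rewrite vpick0 -dimv_eq0; have := dimv_cap_compl l X.
  by rewrite (capv_idPr Xl) dimX dim_l add1n => -[->].
by apply: contra y_neq0 => yX; rewrite -memv0 -(capv_diff l X) memv_cap y_lX.
Qed.

Lemma line_basis l p : is_line l -> p \in l -> p != 0 ->
  exists b, free [:: p; b] /\ l = <<[:: p; b]>>%VS.
Proof.
move=> l_line p_l p_neq0; have p_pt : is_point <[p]>%VS by rewrite /is_point dim_vline p_neq0.
have [b_l bNp] := vpick_diff l_line p_pt p_l; set b := vpick _ in b_l bNp.
have bp_free : free [:: b; p] by rewrite free_cons seq1_free p_neq0 andbT span_seq1.
have pb_free : free [:: p; b].
  by apply/free2P => x y comb0; move/free2P: bp_free => /(_ y x) [|-> ->]; rewrite // addrC.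
exists b; split=> //; apply/esym/eqP; rewrite eqEdim; apply/andP; split.
  by apply/span_subvP => v; rewrite !inE => /orP[] /eqP->.
by move: pb_free l_line; rewrite /free /is_line => /eqP-> /eqP->.
Qed.

End Space.

(** * Roots of polynomials *)

Lemma size_prod_uniform (R : idomainType) (I : Type) (r : seq I) (p : I -> {poly R}) k :
  (forall i, size (p i) <= k.+1)%N ->
  (size (\prod_(i <- r) p i)%R <= (k * size r).+1)%N.
Proof.
move=> p_small; elim: r => [|i r IHr]; first by rewrite big_nil size_poly1 muln0.
rewrite big_cons; apply: leq_trans (size_polyMleq _ _) _.
by have := leq_add (p_small i) IHr; rewrite addSn addnS -mulnS -ltnS; case: addn.
Qed.

Lemma nonroot_exists (R : idomainType) (s : seq R) (p : {poly R}) :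
  uniq s -> p != 0 -> (size p <= size s)%N -> exists2 t, t \in s & p.[t] != 0.
Proof.
move=> s_uniq p_neq0 size_p; apply/allPn/negP.
by move=> /max_poly_roots-/(_ p_neq0 s_uniq); rewrite ltnNge size_p.
Qed.

(** * Cubic forms and their polarizations *)

Section Polarization.

Variables (L : fieldType) (c : 'I_4 -> 'I_4 -> 'I_4 -> L).
Implicit Types (u v w : 'rV[L]_4) (k : L).

(** A trilinear form that need not be symmetric: every cubic form is the
    restriction of one to the diagonal in any characteristic, which would fail
    for symmetric forms in characteristics 2 and 3. *)
Definition tri u v w : L :=
  \sum_i \sum_j \sum_k c i j k * u 0 i * v 0 j * w 0 k.

Definition cubic v := tri v v v.
Definition grad u v := tri u u v + tri u v u + tri v u u.
Definition polar u v w :=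
  tri u v w + tri u w v + tri v u w + tri v w u + tri w u v + tri w v u.

Fact triD1 u u' v w : tri (u + u') v w = tri u v w + tri u' v w.
Proof.
rewrite /tri -big_split; apply: eq_bigr => i _; rewrite -big_split /=.
apply: eq_bigr => j _; rewrite -big_split /=; apply: eq_bigr => k _.
by rewrite mxE; ring.
Qed.

Fact triD2 u v v' w : tri u (v + v') w = tri u v w + tri u v' w.
Proof.
rewrite /tri -big_split; apply: eq_bigr => i _; rewrite -big_split /=.
apply: eq_bigr => j _; rewrite -big_split /=; apply: eq_bigr => k _.
by rewrite mxE; ring.
Qed.

Fact triD3 u v w w' : tri u v (w + w') = tri u v w + tri u v w'.
Proof.
rewrite /tri -big_split; apply: eq_bigr => i _; rewrite -big_split /=.
apply: eq_bigr => j _; rewrite -big_split /=; apply: eq_bigr => k _.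
by rewrite mxE; ring.
Qed.

Fact triZ1 k u v w : tri (k *: u) v w = k * tri u v w.
Proof.
rewrite /tri mulr_sumr; apply: eq_bigr => i _; rewrite mulr_sumr.
apply: eq_bigr => j _; rewrite mulr_sumr; apply: eq_bigr => l _.
by rewrite mxE; ring.
Qed.

Fact triZ2 k u v w : tri u (k *: v) w = k * tri u v w.
Proof.
rewrite /tri mulr_sumr; apply: eq_bigr => i _; rewrite mulr_sumr.
apply: eq_bigr => j _; rewrite mulr_sumr; apply: eq_bigr => l _.
by rewrite mxE; ring.
Qed.

Fact triZ3 k u v w : tri u v (k *: w) = k * tri u v w.
Proof.
rewrite /tri mulr_sumr; apply: eq_bigr => i _; rewrite mulr_sumr.
apply: eq_bigr => j _; rewrite mulr_sumr; apply: eq_bigr => l _.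
by rewrite mxE; ring.
Qed.

Let triE := (triD1, triD2, triD3, triZ1, triZ2, triZ3).

Lemma cubicD u v : cubic (u + v) = cubic u + grad u v + grad v u + cubic v.
Proof. by rewrite /cubic /grad !triE; ring. Qed.

Lemma cubicZ k u : cubic (k *: u) = k ^+ 3 * cubic u.
Proof. by rewrite /cubic !triE; ring. Qed.

Lemma gradDr u v w : grad u (v + w) = grad u v + grad u w.
Proof. by rewrite /grad !triE; ring. Qed.

Lemma gradZr k u v : grad u (k *: v) = k * grad u v.
Proof. by rewrite /grad !triE; ring. Qed.

Lemma gradDl u v w : grad (u + v) w = grad u w + grad v w + polar u v w.
Proof. by rewrite /grad /polar !triE; ring. Qed.

Lemma gradZl k u v : grad (k *: u) v = k ^+ 2 * grad u v.
Proof. by rewrite /grad !triE; ring. Qed.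

Lemma grad_diag u : grad u u = 3 * cubic u.
Proof. by rewrite /grad /cubic; ring. Qed.

Lemma polarC u v w : polar u v w = polar v u w.
Proof. by rewrite /polar; ring. Qed.

Lemma polarCA u v w : polar u v w = polar u w v.
Proof. by rewrite /polar; ring. Qed.

Lemma polarD1 u u' v w : polar (u + u') v w = polar u v w + polar u' v w.
Proof. by rewrite /polar !triE; ring. Qed.

Lemma polarZ1 k u v w : polar (k *: u) v w = k * polar u v w.
Proof. by rewrite /polar !triE; ring. Qed.

Lemma polarD2 u v v' w : polar u (v + v') w = polar u v w + polar u v' w.
Proof. by rewrite polarC polarD1 !(polarC u). Qed.

Lemma polarZ2 k u v w : polar u (k *: v) w = k * polar u v w.
Proof. by rewrite polarC polarZ1 (polarC u). Qed.

Lemma polarD3 u v w w' : polar u v (w + w') = polar u v w + polar u v w'.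
Proof. by rewrite polarCA polarD2 !(polarCA u v). Qed.

Lemma polarZ3 k u v w : polar u v (k *: w) = k * polar u v w.
Proof. by rewrite polarCA polarZ2 (polarCA u v). Qed.

Lemma polar_diag12 u v : polar u u v = 2 * grad u v.
Proof. by rewrite /polar /grad; ring. Qed.

Lemma polar_diag13 u v : polar u v u = 2 * grad u v.
Proof. by rewrite polarCA polar_diag12. Qed.

Lemma polar_diag23 u v : polar v u u = 2 * grad u v.
Proof. by rewrite polarC polar_diag13. Qed.

(** A rewriting rule that puts all six values of polar on u, v, w into the one
    form polar u v w, so that ring can identify them. *)
Lemma polar_perm u v w :
  ((polar u w v = polar u v w) * (polar v u w = polar u v w)
   * (polar v w u = polar u v w) * (polar w u v = polar u v w)
   * (polar w v u = polar u v w))%type.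
Proof. by do !split; rewrite /polar; ring. Qed.

Definition polarE :=
  (cubicD, cubicZ, gradDl, gradDr, gradZl, gradZr, polarD1, polarD2, polarD3,
   polarZ1, polarZ2, polarZ3, grad_diag, polar_diag12, polar_diag13, polar_diag23).

(** The four coefficients of f on the line ab: a condition valid over any field,
    whereas the vanishing of f at the rational points of the line could be weaker
    over a small one. *)
Definition contains_span a b :=
  [/\ cubic a = 0, cubic b = 0, grad a b = 0 & grad b a = 0].

Lemma contains_spanC a b : contains_span a b -> contains_span b a.
Proof. by case. Qed.

Lemma contains_span_cubic a b x y : contains_span a b -> cubic (x *: a + y *: b) = 0.
Proof. by case=> fa fb ab ba; rewrite !polarE fa fb ab ba; ring. Qed.

Lemma contains_span_grad a b x y x' y' : contains_span a b ->
  grad (x *: a + y *: b) (x' *: a + y' *: b) = 0.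
Proof.
by case=> fa fb ab ba; rewrite !polarE fa fb ab ba; ring.
Qed.

Lemma contains_span_comb a b x y x' y' : contains_span a b ->
  contains_span (x *: a + y *: b) (x' *: a + y' *: b).
Proof. by move=> ab; split; rewrite ?contains_span_cubic ?contains_span_grad. Qed.

Lemma third_point u v :
  cubic u = 0 -> cubic v = 0 -> cubic (grad v u *: u + (- grad u v) *: v) = 0.
Proof. by move=> fu fv; rewrite !polarE fu fv; ring. Qed.

Definition smooth_form :=
  forall v, v != 0 -> cubic v = 0 -> exists w, grad v w != 0.

(** The vectors n, a, b span the tangent plane at v, so any vector on which the
    gradient is nonzero completes them to a basis. *)
Lemma exists_off_tangent_plane v n a b :
  smooth_form -> free [:: n; a; b] -> v != 0 -> cubic v = 0 ->
  grad v n = 0 -> grad v a = 0 -> grad v b = 0 ->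
  exists m, grad v m != 0 /\ free [:: m; n; a; b].
Proof.
move=> smooth nab_free v_neq0 fv vn va vb.
have [m vm] := smooth v v_neq0 fv; exists m; split=> //.
rewrite free_cons nab_free andbT; apply: contra vm => /mem_span3[x [y [z ->]]].
by rewrite !(gradDr, gradZr) vn va vb !mulr0 !addr0.
Qed.

(** When the line ab is on the surface, f (x n + y a + z b) = x q(x, y, z), and
    q is the conic residual to the line in the plane abn. This is the
    half-discriminant of q, which detects its singularity also in
    characteristic 2. *)
Definition conic_disc a b n :=
  4 * grad a n * grad b n * cubic n + polar a b n * grad n a * grad n b
  - grad a n * grad n b ^+ 2 - polar a b n ^+ 2 * cubic n
  - grad b n * grad n a ^+ 2.

Lemma disc_base_change a b n x y x' y' : contains_span a b ->
  conic_disc (x *: a + y *: b) (x' *: a + y' *: b) n =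
  (x * y' - y * x') ^+ 2 * conic_disc a b n.
Proof.
case=> fa fb ab ba; rewrite /conic_disc !polarE !(polar_perm a b n) ?fa ?fb ?ab ?ba.
by ring.
Qed.

(** Up to a fifth power the discriminant depends only on the plane abn: it is a
    quintic form on the pencil of planes through the line ab. *)
Lemma disc_translate a b n x y z : contains_span a b ->
  conic_disc a b (x *: n + y *: a + z *: b) = x ^+ 5 * conic_disc a b n.
Proof.
case=> fa fb ab ba; rewrite /conic_disc !polarE.
rewrite !(polar_perm a b n) ?fa ?fb ?ab ?ba.
by ring.
Qed.

Lemma disc_free a b n : free [:: a; b] -> contains_span a b -> conic_disc a b n != 0 ->
  free [:: n; a; b].
Proof.
move=> ab_free ab_in; rewrite free_cons ab_free andbT; apply: contra.
case/mem_span2=> y [z ->]; have := disc_translate 0 0 y z ab_in.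
by rewrite scaler0 add0r expr0n mul0r => ->.
Qed.

End Polarization.

(** * The discriminant along the pencil of planes through a line *)

Section Rational.

Variables (K : fieldType) (c : 'I_4 -> 'I_4 -> 'I_4 -> K).
Local Notation f := (cubic c).
Local Notation D := (grad c).
Local Notation H := (polar c).
Local Notation in_surface := (contains_span c).
Local Notation disc := (conic_disc c).

Hypothesis K_big : at_least 13 K.
Hypothesis smooth : smooth_form c.
Hypothesis not_tangent_along_line : forall a b n, free [:: n; a; b] ->
  in_surface a b -> ~ [/\ D a n = 0, D b n = 0 & H a b n = 0].

Implicit Types (a b n m u v w : 'rV[K]_4).

(** The coefficient of s^4 in disc a b (s n + m). When the conic in the plane abn
    is singular, the coefficient disc a b n of s^5 vanishes and this one, if
    nonzero, shows that abn is a simple zero of the discriminant. *)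
Definition disc_coef4 a b n m :=
  4 * (D a m * D b n * f n + D a n * D b m * f n + D a n * D b n * D n m)
  + H a b m * D n a * D n b + H a b n * (H n m a * D n b + D n a * H n m b)
  - D a m * D n b ^+ 2 - 2 * D a n * H n m b * D n b
  - 2 * H a b m * H a b n * f n - H a b n ^+ 2 * D n m
  - D b m * D n a ^+ 2 - 2 * D b n * H n m a * D n a.

Lemma disc_pencil a b n m : exists p : {poly K},
  [/\ forall s, p.[s] = disc a b (s *: n + m), (size p <= 6)%N,
      p`_5 = disc a b n & p`_4 = disc_coef4 a b n m].
Proof.
(* The coefficients in s of those of the conic in the plane of s n + m. *)
pose A0 := D a m; pose A1 := D a n; pose C0 := D b m; pose C1 := D b n.
pose B0 := H a b m; pose B1 := H a b n.
pose D0 := D m a; pose D1 := H n m a; pose D2 := D n a.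
pose E0 := D m b; pose E1 := H n m b; pose E2 := D n b.
pose G0 := f m; pose G1 := D m n; pose G2 := D n m; pose G3 := f n.
pose p : seq K := [::
  4 * A0 * C0 * G0 + B0 * D0 * E0 - A0 * E0 * E0 - B0 * B0 * G0 - C0 * D0 * D0;
  4 * (A0 * C0 * G1 + A0 * C1 * G0 + A1 * C0 * G0)
  + B0 * D0 * E1 + B0 * D1 * E0 + B1 * D0 * E0 - 2 * A0 * E0 * E1
  - A1 * E0 * E0 - B0 * B0 * G1 - 2 * B0 * B1 * G0 - 2 * C0 * D0 * D1
  - C1 * D0 * D0;
  4 * (A0 * C0 * G2 + A0 * C1 * G1 + A1 * C0 * G1 + A1 * C1 * G0)
  + B0 * D0 * E2 + B0 * D1 * E1 + B1 * D0 * E1 + B0 * D2 * E0 + B1 * D1 * E0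
  - 2 * A0 * E0 * E2 - A0 * E1 * E1 - 2 * A1 * E0 * E1 - B0 * B0 * G2
  - 2 * B0 * B1 * G1 - B1 * B1 * G0 - 2 * C0 * D0 * D2 - C0 * D1 * D1
  - 2 * C1 * D0 * D1;
  4 * (A0 * C0 * G3 + A0 * C1 * G2 + A1 * C0 * G2 + A1 * C1 * G1)
  + B0 * D1 * E2 + B1 * D0 * E2 + B0 * D2 * E1 + B1 * D1 * E1 + B1 * D2 * E0
  - 2 * A0 * E1 * E2 - 2 * A1 * E0 * E2 - A1 * E1 * E1 - B0 * B0 * G3
  - 2 * B0 * B1 * G2 - B1 * B1 * G1 - 2 * C0 * D1 * D2 - 2 * C1 * D0 * D2
  - C1 * D1 * D1;
  disc_coef4 a b n m; disc a b n].
exists (Poly p); split; [|exact: size_Poly|by rewrite coef_Poly..].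
move=> s; rewrite horner_Poly /= /disc_coef4 /conic_disc !polarE.
by rewrite /A0 /A1 /B0 /B1 /C0 /C1 /D0 /D1 /D2 /E0 /E1 /E2 /G0 /G1 /G2 /G3; ring.
Qed.

(** The points t a + b to avoid are those tangent to the plane abn, at most 2,
    and those tangent to the plane of s n + m for one of the at most 5 roots s of
    disc a b (s n + m), at most 2 for each. The vector
    D a' m *: n - D a' n *: m completes a, b to a basis of the tangent plane
    at a'. *)
Lemma good_point_exists a b n m : free [:: m; n; a; b] -> in_surface a b ->
  disc a b n != 0 \/ disc_coef4 a b n m != 0 ->
  exists t, let a' := t *: a + b in
    D a' n != 0 /\ disc a' a (D a' m *: n + (- D a' n) *: m) != 0.
Proof.
move=> mnab_free ab disc_neq0.
have nab_free : free [:: n; a; b] by move: mnab_free; rewrite free_cons => /andP[].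
have mn_free s : free [:: s *: n + m; a; b].
  move: mnab_free nab_free; rewrite free_cons => /andP[m_nab _].
  rewrite !(free_cons _ [:: a; b]) => /andP[_ ->]; rewrite andbT.
  apply: contra m_nab.
  case/mem_span2=> x [y snm]; apply/mem_span3; exists (- s), x, y.
  by rewrite -addrA -snm scaleNr addKr.
have [p [pE size_p p5 p4]] := disc_pencil a b n m.
have p_neq0 : p != 0.
  by apply/eqP => p0; case: disc_neq0; rewrite -?p5 -?p4 p0 coef0 eqxx.
(* The roots of quad v are the points t a + b at which the plane abv is tangent. *)
pose quad v : {poly K} := Poly [:: D b v; H a b v; D a v].
have quadE v t : (quad v).[t] = D (t *: a + b) v.
  by rewrite horner_Poly /= !polarE; ring.
have quad_neq0 v : free [:: v; a; b] -> quad v != 0.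
  move=> vab_free; apply/eqP => quad0.
  apply: (not_tangent_along_line vab_free ab).
  have coef_quad i : [:: D b v; H a b v; D a v]`_i = 0.
    by rewrite -coef_Poly -/(quad v) quad0 coef0.
  by split; [have := coef_quad 2 | have := coef_quad 0 | have := coef_quad 1].
have [s0 [s0_uniq size_s0]] := K_big.
pose s := [seq t <- s0 | (quad n).[t] != 0].
(* The tangent plane at t a + b is that of slope t n + m. *)
pose slope t := - ((quad m).[t] / (quad n).[t]).
(* Only the roots that occur as slopes are needed, and K can be infinite, so the
   list of roots is cut out of the slopes at the elements of s. *)
pose r := [seq x <- undup (map slope s) | root p x].
have size_r : (size r <= 5)%N.
  rewrite -ltnS; apply: leq_trans size_p; apply: max_poly_roots => //.
    exact: filter_all.
  by rewrite filter_uniq ?undup_uniq.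
pose q := quad n * \prod_(x <- r) quad (x *: n + m).
have q_neq0 : q != 0.
  rewrite mulf_neq0 ?quad_neq0 //; elim: (r) => [|x r' IHr].
    by rewrite big_nil oner_eq0.
  by rewrite big_cons mulf_neq0 // quad_neq0.
have size_q : (size q <= size s0)%N.
  have size_quad v : (size (quad v) <= 3)%N by apply: size_Poly.
  have size_prod : (size (\prod_(x <- r) quad (x *: n + m))%R <= 11)%N.
    have := size_prod_uniform r (fun x => size_quad (x *: n + m)).
    move=> /leq_trans; apply.
    by rewrite ltnS (leq_mul2l 2 _ 5).
  apply: leq_trans size_s0; apply: leq_trans (size_polyMleq _ _) _.
  by have := leq_add (size_quad n) size_prod; case: addn.
have [t t_s0] := nonroot_exists s0_uniq q_neq0 size_q.
rewrite hornerM mulf_eq0 negb_or => /andP[nt rt]; exists t => /=.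
split; first by rewrite -quadE.
have t_s : t \in s by rewrite mem_filter nt.
have px : p.[slope t] != 0.
  apply: contra rt => px; have x_r : slope t \in r.
    by rewrite mem_filter mem_undup map_f // andbT.
  rewrite (big_rem _ x_r) /= hornerM mulf_eq0 quadE gradDr gradZr -!quadE.
  by rewrite /slope mulNr divfK // addNr eqxx.
have -> : D (t *: a + b) m *: n + - D (t *: a + b) n *: m =
    (- D (t *: a + b) n) *: (slope t *: n + m) + 0 *: (t *: a + b) + 0 *: a.
  rewrite !scale0r !addr0 scalerDr scalerA /slope -!quadE mulrNN mulrC divfK //.
rewrite disc_translate; last first.
  by have := contains_span_comb t 1 1 0 ab; rewrite !scale1r scale0r addr0.
have := disc_base_change (slope t *: n + m) t 1 1 0 ab.
rewrite !scale1r scale0r addr0 => ->; rewrite -pE.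
by rewrite mulr0 sub0r mulr1 sqrrN expr1n mul1r mulf_neq0 // expf_neq0 // oppr_eq0 -quadE.
Qed.

(** * Secant and tangent moves *)

Variable S : 'rV[K]_4 -> Prop.
Hypothesis S_cubic : forall v, S v -> f v = 0.
Hypothesis S_scale : forall k v, k != 0 -> S v -> S (k *: v).
Hypothesis S_secant : forall u v, S u -> S v -> (D u v != 0) || (D v u != 0) ->
  S (D v u *: u + (- D u v) *: v).
Hypothesis S_tangent : forall u v, S u -> f v = 0 -> D u v = 0 -> D v u != 0 ->
  S v.

Definition covered a b := forall y z, y *: a + z *: b != 0 -> S (y *: a + z *: b).

Lemma S_unscale k v : k != 0 -> S (k *: v) -> S v.
Proof.
move=> k_neq0 /(S_scale (invr_neq0 k_neq0)).
by rewrite scalerA mulVf // scale1r.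
Qed.

(** The two moves as one: v is reached from u if the third point of the line uv
    is known, because that point and u then have v as their third point; if
    grad u v = 0 the third point is u itself and the tangent move applies. *)
Lemma S_chord u v : S u -> f v = 0 -> D v u != 0 ->
  (D u v != 0 -> S (D v u *: u + (- D u v) *: v)) -> S v.
Proof.
move=> Su fv vu; have [uv0 _|uv /(_ isT)Sw] := eqVneq (D u v) 0.
  exact: S_tangent vu.
set p := D u v in uv Sw *; set q := D v u in vu Sw *; set w := _ + _ in Sw.
have fu := S_cubic Su.
have uw : D u w = - p ^+ 2 by rewrite /w !polarE fu -/p; ring.
have wu : D w u = - (p ^+ 2 * q).
  by rewrite /w !polarE fu -/p -/q; ring.
have := S_secant Su Sw; rewrite uw oppr_eq0 expf_neq0 // => /(_ isT).
have -> : D w u *: u + - - p ^+ 2 *: w = (- p ^+ 3) *: v.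
  by rewrite wu /w scalerDr !scalerA addrA -scalerDl !opprK addNr scale0r add0r;
    congr (_ *: v); ring.
by apply: S_unscale; rewrite oppr_eq0 expf_neq0.
Qed.

(** * Lines in tangent planes with a smooth residual conic *)

(** The tangent move from a reaches v unless the line av is tangent to the conic
    at a; as av meets a smooth conic also in v, that cannot happen. *)
Lemma conic_covered a b n x y z : in_surface a b -> D a n = 0 ->
  disc a b n != 0 -> S a -> x != 0 -> f (x *: n + y *: a + z *: b) = 0 ->
  S (x *: n + y *: a + z *: b).
Proof.
move=> [fa fb ab ba] an disc_neq0 Sa x_neq0 fv.
apply: (S_tangent Sa fv); first by rewrite !polarE fa ab an; ring.
have -> : D (x *: n + y *: a + z *: b) a = x * (x * D n a + z * H a b n).
  by rewrite !polarE !(polar_perm c a b n) fa ab ba an; ring.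
rewrite mulf_neq0 //; apply: contra disc_neq0 => /eqP tangent.
(* If av were tangent, the conic would contain it, and its discriminant vanish. *)
have residual : x ^+ 2 * f n + x * z * D n b + z ^+ 2 * D b n = 0.
  apply: (mulfI x_neq0); rewrite mulr0 -fv.
  rewrite -[LHS]addr0 -(mulr0 (x * y)) -{1}tangent.
  by rewrite !polarE !(polar_perm c a b n) fa fb ab ba an; ring.
have : x ^+ 2 * disc a b n = 0; last first.
  by move/eqP; rewrite mulf_eq0 expf_eq0 (negPf x_neq0).
have -> : x ^+ 2 * disc a b n =
  - H a b n ^+ 2 * (x ^+ 2 * f n + x * z * D n b + z ^+ 2 * D b n)
  + (x * D n a + z * H a b n) *
    (x * H a b n * D n b + D b n * (z * H a b n - x * D n a)).
  by rewrite /conic_disc an; ring.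
by rewrite residual tangent; ring.
Qed.

(** The condition D v n != 0 says that v is not on the residual conic. A line
    from v to a point u of the conic off ab meets the conic again in a point
    off ab, so it is a chord (or a tangent) with v as third point. *)
Lemma line_covered_off_conjugate a b n y z : in_surface a b -> D a n = 0 ->
  disc a b n != 0 -> S a -> D (y *: a + z *: b) n != 0 -> S (y *: a + z *: b).
Proof.
move=> ab_in an disc_neq0 Sa; set v := y *: a + z *: b => vn.
have [fa fb ab ba] := ab_in.
have fv : f v = 0 by apply: contains_span_cubic.
have cover := conic_covered ab_in an disc_neq0 Sa.
(* The point u of the residual conic lies on the line through a and n + t b, which
   must not be the tangent of the conic at a; one of t = 0 and t = 1 will do. *)
have [t u_neq0] : exists t, D n a + t * H a b n != 0.
  have [na0|na] := eqVneq (D n a) 0; last by exists 0; rewrite mul0r addr0.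
  exists 1; rewrite na0 add0r mul1r; apply: contra disc_neq0 => /eqP abn0.
  by rewrite /conic_disc an na0 abn0; apply/eqP; ring.
set k := D n a + t * H a b n in u_neq0.
pose r := f n + t * D n b + t ^+ 2 * D b n.
pose u := k *: n + (- r) *: a + (t * k) *: b.
have fu : f u = 0.
  rewrite /u !polarE !(polar_perm c a b n) fa fb ab ba an /r.
  by rewrite /k; ring.
have Su : S u by apply: cover.
have vu : D v u = k * D v n.
  by rewrite /u !(gradDr, gradZr) /v !(polarE, polar_perm c a b n) fa fb ab ba; ring.
apply: (S_chord Su fv); first by rewrite vu mulf_neq0.
move=> _; set p := D u v; set q := D v u.
have w_eq : q *: u + (- p) *: v = (q * k) *: n + (- q * r - p * y) *: a
    + (q * t * k - p * z) *: b.
  rewrite /u /v; apply/rowP => i; rewrite !mxE; ring.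
rewrite w_eq; apply: cover; first by rewrite !mulf_neq0 // /q vu mulf_neq0.
by rewrite -w_eq third_point.
Qed.

(** A point v of the line is reached from a unless v is on the conic of a, and
    from a second point a' unless v is on the conic of a'. If it were on both,
    the tangent plane at v would contain the two distinct planes tangent at a
    and a', and the gradient would vanish at v. *)
Lemma line_covered_smooth a b n : free [:: n; a; b] -> in_surface a b ->
  D a n = 0 -> disc a b n != 0 -> S a -> covered a b.
Proof.
move=> nab_free ab_in an disc_neq0 Sa y z; set v := _ + _ => v_neq0.
have [fa fb ab ba] := ab_in.
have a_neq0 : a != 0 by apply: (free_not0 nab_free); rewrite !inE eqxx orbT.
have aa : D a a = 0 by rewrite grad_diag fa mulr0.
have [m [am mnab_free]] := exists_off_tangent_plane smooth nab_free a_neq0 fa an aa ab.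
have [t /= [a'n disc'_neq0]] := good_point_exists mnab_free ab_in (or_introl disc_neq0).
set a' := t *: a + b in a'n disc'_neq0; set n' := _ + _ in disc'_neq0.
have a'E : a' = t *: a + 1 *: b by rewrite scale1r.
have Sa' : S a'.
  by rewrite a'E; apply: line_covered_off_conjugate ab_in an disc_neq0 Sa _; rewrite -a'E.
have a'n' : D a' n' = 0 by rewrite /n' gradDr !gradZr; ring.
have a'a_in : in_surface a' a.
  by have := contains_span_comb t 1 1 0 ab_in; rewrite -a'E scale1r scale0r addr0.
have [vn|vn] := eqVneq (D v n) 0; last exact: (line_covered_off_conjugate ab_in an).
have vE : v = z *: a' + (y - z * t) *: a.
  by rewrite /v /a'; apply/rowP => i; rewrite !mxE; ring.
have [vn'|vn'] := eqVneq (D v n') 0; last first.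
  by rewrite vE; apply: (line_covered_off_conjugate a'a_in a'n') => //; rewrite -vE.
have fv : f v = 0 by apply: contains_span_cubic.
have [w /eqP[]] := smooth v_neq0 fv.
have vm : D v m = 0.
  move: vn'; rewrite /n' gradDr !gradZr vn mulr0 add0r => /eqP.
  by rewrite mulf_eq0 oppr_eq0 (negPf a'n) /= => /eqP.
have [x1 [x2 [x3 [x4 ->]]]] := basis4_decomp w mnab_free.
have va : D v a = 0.
  by have := contains_span_grad y z 1 0 ab_in; rewrite scale1r scale0r addr0.
have vb : D v b = 0.
  by have := contains_span_grad y z 0 1 ab_in; rewrite scale1r scale0r add0r.
by rewrite !(gradDr, gradZr) vm vn va vb; ring.
Qed.

(** * Tangent planes that cut out three lines *)

Definition triangle a b n :=
  [/\ in_surface a b, in_surface a n, in_surface b n & H a b n != 0].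

Lemma triangleC a b n : triangle a b n -> triangle b a n.
Proof. by case=> /contains_spanC ab an bn abn; split; rewrite // polarC. Qed.

Lemma triangle_rot a b n : triangle a b n -> triangle n a b.
Proof.
by case=> ab /contains_spanC na /contains_spanC nb abn; split; rewrite // (polar_perm c a b n).
Qed.

(** A point of the side bn other than b and n is joined to a by a line that meets
    the surface twice at a. *)
Lemma triangle_opposite_side a b n x z : triangle a b n -> S a ->
  x != 0 -> z != 0 -> S (x *: b + z *: n).
Proof.
move=> [[fa fb ab ba] [_ fn an na] bn_in abn] Sa x_neq0 z_neq0.
apply: (S_tangent Sa); first exact: contains_span_cubic.
  by rewrite !polarE ab an; ring.
rewrite !polarE ba na !(polar_perm c a b n) !mulr0 !add0r !mulf_neq0 //.
Qed.

(** The discriminant vanishes on the plane abn, but only simply: the next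
    coefficient is - (H a b n)^2 D n m, where D n m != 0 by smoothness at n. *)
Lemma triangle_good_point a b n : free [:: n; a; b] -> triangle a b n ->
  exists m t, let a' := t *: a + b in
    D a' n != 0 /\ disc a' a (D a' m *: n + (- D a' n) *: m) != 0.
Proof.
move=> nab_free [ab_in an_in bn_in abn].
have [fa fb ab ba] := ab_in; have [_ fn an na] := an_in; have [_ _ bn nb] := bn_in.
have n_neq0 : n != 0 by apply: (free_not0 nab_free); rewrite !inE eqxx.
have nn : D n n = 0 by rewrite grad_diag fn mulr0.
have [m [nm mnab_free]] := exists_off_tangent_plane smooth nab_free n_neq0 fn nn na nb.
have [|t good_t] := good_point_exists mnab_free ab_in; last by exists m, t.
right; rewrite /disc_coef4 an bn fn na nb.
set e := (X in X != 0).
have -> : e = - (H a b n ^+ 2 * D n m) by rewrite /e; ring.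
by rewrite oppr_eq0 mulf_neq0 // expf_neq0.
Qed.

Lemma triangle_line_covered a b n : free [:: n; a; b] -> triangle a b n ->
  S a -> covered a b.
Proof.
move=> nab_free abn Sa y z v_neq0.
have anb_free : free [:: a; n; b].
  apply/free3P => x0 x1 x2 comb0; move/free3P: nab_free => /(_ x1 x0 x2) [|-> -> ->//].
  by rewrite (addrC (x1 *: n)).
have nb_free : free [:: n; b] by move: anb_free; rewrite free_cons => /andP[].
(* From a to the side bn, along it to its end n, and from n back to the side ab. *)
have nba := triangleC (triangle_rot (triangle_rot abn)).
have [m [t /= [a'a disc_neq0]]] := triangle_good_point anb_free nba.
set a' := t *: n + b in a'a disc_neq0; set n' := _ + _ in disc_neq0.
have [nb_in na_in ba_in nba_neq0] := nba.
have t_neq0 : t != 0.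
  apply: contra a'a => /eqP t0; rewrite /a' t0 scale0r add0r.
  by case: ba_in => _ _ ->.
have Sa' : S a'.
  have := triangle_opposite_side abn Sa (oner_neq0 K) t_neq0.
  by rewrite scale1r addrC.
have a'n_in : in_surface a' n.
  by have := contains_span_comb t 1 1 0 nb_in; rewrite !scale1r scale0r addr0.
have a'n_free : free [:: a'; n].
  apply/free2P => x x' comb0; move/free2P: nb_free => /(_ (x * t + x') x) [].
    by rewrite -comb0 /a'; apply/rowP => i; rewrite !mxE; ring.
  by move=> + x0; rewrite x0 mul0r add0r.
have a'n' : D a' n' = 0 by rewrite /n' gradDr !gradZr; ring.
have cover := line_covered_smooth (disc_free (c := c) a'n_free a'n_in disc_neq0) a'n_in a'n'
  disc_neq0 Sa'.
have [n_neq0 b_neq0] : n != 0 /\ b != 0.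
  by split; rewrite (free_not0 nab_free) ?inE ?eqxx ?orbT.
have Sn : S n by have := cover 0 1; rewrite scale0r add0r scale1r; apply.
have Sb : S b.
  have := cover 1 (- t); rewrite /a' scale1r scaleNr addrC addKr; exact.
have [y0|y_neq0] := eqVneq y 0.
  move: v_neq0; rewrite y0 scale0r add0r scaler_eq0 negb_or => /andP[z_neq0 _].
  exact: S_scale.
have [z0|z_neq0] := eqVneq z 0; first by rewrite z0 scale0r addr0; apply: S_scale.
exact: triangle_opposite_side (triangle_rot abn) Sn y_neq0 z_neq0.
Qed.

(** A singular conic that is smooth at the rational point a splits over K: it is
    the tangent at a and another line. Here b' is the point where the latter
    meets ab, and n' is the singular point of the conic, scaled to avoid
    denominators; its coordinates solve the two partial derivatives of the conic
    along a and b. *)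
Lemma singular_conic_triangle a b n : free [:: n; a; b] -> in_surface a b ->
  D a n = 0 -> (D n a != 0) || (H a b n != 0) -> disc a b n = 0 ->
  let b' := H a b n *: b + (- D b n) *: a in
  exists n', [/\ H a b n != 0, free [:: n'; a; b'] & triangle a b' n'].
Proof.
move=> nab_free ab_in an smooth_at_a disc0 /=; have [fa fb ab ba] := ab_in.
have abn : H a b n != 0.
  apply/eqP => abn0; move: smooth_at_a; rewrite abn0 eqxx orbF => na.
  apply: (not_tangent_along_line nab_free ab_in); split=> //.
  move/eqP: disc0; rewrite /conic_disc an abn0 !(mul0r, mulr0) expr0n mul0r !subr0 add0r.
  by rewrite sub0r oppr_eq0 mulf_eq0 expf_eq0 (negPf na) orbF => /eqP.
set p := H a b n in abn *; set q := D b n; set b' := _ + _.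
pose d := D n a; pose e := D n b.
pose n' := p ^+ 2 *: n + (2 * q * d - e * p) *: a + (- (d * p)) *: b.
have polar_n' : H a b' n' = p ^+ 4.
  rewrite /b' /n' !polarE ?(polar_perm c a b n) ?fa ?ab ?ba ?an -/p; ring.
exists n'; split=> //.
  apply/free3P => x y z comb0; move/free3P: nab_free.
  move/(_ (x * p ^+ 2) (x * (2 * q * d - e * p) + y - z * q) (z * p - x * d * p)) => [].
    by rewrite -comb0 /b' /n'; apply/rowP => i; rewrite !mxE; ring.
  move/eqP; rewrite mulf_eq0 expf_eq0 (negPf abn) orbF => /eqP-> + /eqP.
  rewrite !mul0r subr0 add0r mulf_eq0 (negPf abn) orbF => + /eqP z0.
  by rewrite z0 mul0r subr0.
have disc_eq : f n' = - p ^+ 4 * disc a b n.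
  rewrite /n' /conic_disc !polarE ?(polar_perm c a b n) ?fa ?fb ?ab ?ba ?an -/p -/q -/d -/e.
  ring.
split; rewrite ?polar_n' ?expf_neq0 //; split=> //.
all: rewrite ?disc_eq ?disc0 ?mulr0 //.
all: rewrite /n' /b' !polarE ?(polar_perm c a b n) ?fa ?fb ?ab ?ba ?an -/p -/q -/d -/e.
all: ring.
Qed.

(** * Covering the lines and the surface *)

Lemma line_covered a b n : free [:: n; a; b] -> in_surface a b -> D a n = 0 ->
  (D n a != 0) || (H a b n != 0) -> S a -> covered a b.
Proof.
move=> nab_free ab_in an smooth_at_a Sa y z.
have [disc0|disc_neq0] := eqVneq (disc a b n) 0; last exact: (line_covered_smooth nab_free).
have [n' [abn n'_free]] := singular_conic_triangle nab_free ab_in an smooth_at_a disc0.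
set b' := _ + _ => tri; have := triangle_line_covered n'_free tri Sa.
have -> : y *: a + z *: b =
    (y + z * D b n / H a b n) *: a + (z / H a b n) *: b'.
  rewrite /b' scalerDr !scalerA divfK // addrCA -scalerDl addrC.
  by congr (_ *: a + _); field.
exact.
Qed.

(** Produces the plane through ab from which the span passes to a skew line. *)
Lemma smooth_conic_exists a b n : free [:: n; a; b] -> in_surface a b ->
  D a n = 0 -> (D n a != 0) || (H a b n != 0) ->
  exists t n', D (t *: a + b) n' = 0 /\ disc (t *: a + b) a n' != 0.
Proof.
move=> nab_free ab_in an smooth_at_a.
have [disc0|disc_neq0] := eqVneq (disc a b n) 0; last first.
  have [fa _ ab _] := ab_in.
  have a_neq0 : a != 0 by apply: (free_not0 nab_free); rewrite !inE eqxx orbT.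
  have aa : D a a = 0 by rewrite grad_diag fa mulr0.
  have [m [_ mnab_free]] := exists_off_tangent_plane smooth nab_free a_neq0 fa an aa ab.
  have [t [_ disc'_neq0]] := good_point_exists mnab_free ab_in (or_introl disc_neq0).
  exists t, (D (t *: a + b) m *: n + (- D (t *: a + b) n) *: m); split=> //.
  by rewrite gradDr !gradZr; ring.
have [n1 [abn n1_free]] := singular_conic_triangle nab_free ab_in an smooth_at_a disc0.
set b' := _ + _ => tri.
have [m [t /= [_]]] := triangle_good_point n1_free tri.
set n' := (X in disc _ _ X).
have n'0 : D (t *: a + b') n' = 0 by rewrite /n' gradDr !gradZr; ring.
pose t' := (t - D b n) / H a b n; pose a' := t' *: a + b.
have a'E : t *: a + b' = H a b n *: a' + 0 *: a.
  rewrite /a' /t' /b'; apply/rowP => i; rewrite !mxE; field; exact: abn.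
have a'a_in : in_surface a' a.
  by have := contains_span_comb t' 1 1 0 ab_in; rewrite !scale1r scale0r addr0.
have := disc_base_change n' (H a b n) 0 0 1 a'a_in.
rewrite -a'E scale0r scale1r add0r => ->.
rewrite mulf_eq0 negb_or => /andP[_ disc_neq0]; exists t', n'; split=> //.
move/eqP: n'0; rewrite a'E scale0r addr0 gradZl mulf_eq0 expf_eq0 (negPf abn) /=.
by move/eqP.
Qed.

(** The plane of n meets the line de in a point w of its smooth conic, so w is in
    S. The tangent plane at w meets the line ab in u. If D u w were also 0, then
    the line uw would be on the surface and be part of the conic, which is
    smooth; and D u w != 0 makes the conic residual to de at w smooth at w. *)
Lemma skew_line_covered a b d e : free [:: a; b; d; e] ->
  in_surface a b -> in_surface d e ->
  (exists t n, D (t *: a + b) n = 0 /\ disc (t *: a + b) a n != 0) ->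
  covered a b -> covered d e.
Proof.
move=> free4 ab_in de_in [t [n [a'n disc_neq0]]] cover y0 z0 v_neq0.
set a' := t *: a + b in a'n disc_neq0.
have a'a_in : in_surface a' a.
  by have := contains_span_comb t 1 1 0 ab_in; rewrite !scale1r scale0r addr0.
have [y [z [p [q nE]]]] := basis4_decomp n free4.
set w := p *: d + q *: e in nE.
have wE : w = 1 *: n + (- z) *: a' + (z * t - y) *: a.
  by rewrite nE /a'; apply/rowP => i; rewrite !mxE; ring.
have w_neq0 : w != 0.
  apply: contra disc_neq0 => /eqP w0; rewrite nE w0 addr0.
  have -> : y *: a + z *: b = 0 *: n + z *: a' + (y - z * t) *: a.
    by rewrite /a'; apply/rowP => i; rewrite !mxE; ring.
  by rewrite disc_translate // expr0n mul0r.
have fw : f w = 0 by apply: contains_span_cubic.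
have Sa' : S a'.
  have := cover t 1; rewrite scale1r; apply; apply: contra disc_neq0 => /eqP a'0.
  by rewrite /a' a'0 -(scale0r a) /conic_disc !polarE; apply/eqP; ring.
have Sw : S w.
  by rewrite wE; apply: (conic_covered a'a_in a'n); rewrite ?oner_eq0 // -wE.
pose u := D w b *: a + (- D w a) *: b.
have wu : D w u = 0 by rewrite /u gradDr !gradZr; ring.
have u_neq0 : u != 0.
  apply/eqP => u0; have [r /eqP[]] := smooth w_neq0 fw.
  have /free4P/(_ (D w b) (- D w a) 0 0) := free4.
  rewrite !scale0r !addr0 => /(_ u0)[wb /eqP + _ _]; rewrite oppr_eq0 => /eqP wa.
  have [y1 [z1 [p1 [q1 ->]]]] := basis4_decomp r free4.
  have wde : D w (p1 *: d + q1 *: e) = 0 by apply: contains_span_grad.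
  by rewrite gradDr wde gradDr !gradZr wa wb; ring.
have uw : D u w != 0.
  apply: contra disc_neq0 => /eqP uw0.
  have uE : u = (- D w a) *: a' + (D w b + D w a * t) *: a.
    by rewrite /u /a'; apply/rowP => i; rewrite !mxE; ring.
  have [y' [z' det]] : exists y' z', (- D w a) * z' - (D w b + D w a * t) * y' != 0.
    by apply: (@span2_complement _ a' a); rewrite -uE.
  have := disc_base_change w (- D w a) (D w b + D w a * t) y' z' a'a_in.
  have -> : disc a' a w = disc a' a n.
    by rewrite wE disc_translate // expr1n mul1r.
  (* In a basis of ab that starts with u, all terms of the discriminant vanish
     with D u w, D w u and f w. *)
  rewrite -uE {1}/conic_disc uw0 wu fw.
  set l := (X in X = _); have -> : l = 0 by rewrite /l; ring.
  by move/esym/eqP; rewrite mulf_eq0 expf_eq0 (negPf det).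
have [y' [z' det]] := span2_complement w_neq0.
set w' := y' *: d + z' *: e.
have ww'_in : in_surface w w' by apply: contains_span_comb.
have uww'_free : free [:: u; w; w'].
  apply/free3P => x1 x2 x3 comb0.
  have /free4P/(_ (x1 * D w b) (- x1 * D w a) (x2 * p + x3 * y') (x2 * q + x3 * z')) := free4.
  case=> [|xb xa xd xe].
    by rewrite -comb0 /u /w /w'; apply/rowP => i; rewrite !mxE; ring.
  have x1u : x1 *: u = 0.
    by rewrite /u scalerDr !scalerA xb mulrN -mulNr xa !scale0r addr0.
  move/eqP: x1u; rewrite scaler_eq0 (negPf u_neq0) orbF => /eqP x10.
  have x2d : x2 * (p * z' - q * y') = 0.
    by transitivity (z' * (x2 * p + x3 * y') - y' * (x2 * q + x3 * z'));
      [ring | rewrite xd xe !mulr0 subrr].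
  have x3d : x3 * (p * z' - q * y') = 0.
    by transitivity (p * (x2 * q + x3 * z') - q * (x2 * p + x3 * y'));
      [ring | rewrite xd xe !mulr0 subrr].
  move/eqP: x2d; move/eqP: x3d; rewrite !mulf_eq0 (negPf det) !orbF.
  by move=> /eqP-> /eqP->.
have [y1 [z1 vE]] := span2_change_basis d e y0 z0 det.
move: v_neq0; rewrite vE; apply: (line_covered uww'_free) => //.
by rewrite uw.
Qed.

(** The lines ux and uv are on the surface, and so is the point u + v. If the
    conic residual to uv in the plane uvx is smooth at u, line_covered applies
    to uv. Otherwise the three lines of this plane all pass through u. The line
    through x and u + v then meets the third one in u1 + v1, with u1 on the line
    ux and v1 proportional to v, and the line through u1 and v1 is not on the
    surface. So a secant move gives u1 + v1, and then a chord gives u + v. *)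
Lemma transversal_covered u v x : free [:: x; u; v] -> in_surface u x ->
  in_surface u v -> covered u x -> S v -> S (u + v).
Proof.
move=> xuv_free ux_in uv_in cover Sv; have [fu fv uv vu] := uv_in.
have [_ fx ux xu] := ux_in.
have uxv_free (k l m : K) : k *: u + l *: x + m *: v = 0 -> [/\ k = 0, l = 0 & m = 0].
  by rewrite (addrC (k *: u)); move/free3P: xuv_free => /[apply] -[].
have x_neq0 : x != 0 by apply: (free_not0 xuv_free); rewrite !inE eqxx.
have u_neq0 : u != 0 by apply: (free_not0 xuv_free); rewrite !inE eqxx orbT.
have Su : S u by have := cover 1 0; rewrite scale0r addr0 scale1r; apply.
have Sx : S x by have := cover 0 1; rewrite scale0r add0r scale1r; apply.
have [uvx|uvx] := eqVneq (H u v x) 0; last first.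
  have := line_covered xuv_free uv_in ux; rewrite uvx orbT => /(_ isT Su 1 1).
  rewrite !scale1r; apply; apply/eqP => uv0.
  have [|/eqP] := uxv_free 1 0 1; last by rewrite oner_eq0.
  by rewrite scale0r addr0 !scale1r.
(* In the plane uvx, f (i v + j u + h x) = i h (k i + l h): smoothness makes the
   three lines distinct. *)
set k := D v x; set l := D x v.
have l_neq0 : l != 0.
  apply/eqP => l0; have vux_free : free [:: v; u; x].
    by apply/free3P => i j h; rewrite -addrA addrC => /uxv_free[-> -> ->].
  by apply: (not_tangent_along_line vux_free ux_in); rewrite polarCA.
have k_neq0 : k != 0.
  by apply/eqP => k0; apply: (not_tangent_along_line xuv_free uv_in).
have fuv : f (u + v) = 0 by rewrite cubicD fu fv uv vu !addr0.
have rx : D (u + v) x = k by rewrite gradDl ux uvx add0r addr0.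
have xr : D x (u + v) = l by rewrite gradDr xu add0r.
apply: (S_chord Sx fuv); rewrite rx // xr => _.
pose u1 := (- l) *: u + k *: x; pose v1 := (- l) *: v.
have -> : k *: x + - l *: (u + v) = u1 + v1.
  by rewrite /u1 /v1 scalerDr addrA (addrC (k *: x)).
have Su1 : S u1.
  apply: cover; apply/eqP => u10; have [] := uxv_free (- l) k 0.
    by rewrite scale0r addr0.
  by move=> _ /eqP; rewrite (negPf k_neq0).
have Sv1 : S v1 by apply: S_scale; rewrite ?oppr_eq0.
have u1v1 : D u1 v1 = - (l ^+ 2 * k ^+ 2).
  by rewrite /u1 /v1 !polarE -/l uv !(polar_perm c u v x) uvx; ring.
have v1u1 : D v1 u1 = l ^+ 2 * k ^+ 2.
  by rewrite /u1 /v1 !polarE -/k vu; ring.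
have lk_neq0 : l ^+ 2 * k ^+ 2 != 0 by rewrite mulf_neq0 ?expf_neq0.
have := S_secant Su1 Sv1; rewrite v1u1 u1v1 opprK -scalerDr lk_neq0 orbT.
by move=> /(_ isT); apply: S_unscale.
Qed.

Lemma surface_covered a b d e : free [:: a; b; d; e] ->
  in_surface a b -> in_surface d e ->
  covered a b -> covered d e ->
  forall r, r != 0 -> f r = 0 -> S r.
Proof.
move=> free4 ab_in de_in cover_ab cover_de r r_neq0 fr.
have [y [z [p [q rE]]]] := basis4_decomp r free4.
set u := y *: a + z *: b in rE; set v := p *: d + q *: e in rE.
have [u0|u_neq0] := eqVneq u 0.
  by move: r_neq0; rewrite rE u0 add0r; apply: cover_de.
have [v0|v_neq0] := eqVneq v 0.
  by move: r_neq0; rewrite rE v0 addr0; apply: cover_ab.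
have Su : S u by apply: cover_ab.
have Sv : S v by apply: cover_de.
have [fu fv] : f u = 0 /\ f v = 0 by split; apply: S_cubic.
have vu : D v u = - D u v.
  by apply/eqP; rewrite -addr_eq0 addrC; move: fr; rewrite rE cubicD fu fv add0r addr0 => ->.
have [uv|uv] := eqVneq (D u v) 0; last first.
  have := S_secant Su Sv; rewrite uv vu => /(_ isT).
  by rewrite -scalerDr -rE; apply: S_unscale; rewrite oppr_eq0.
rewrite uv oppr0 in vu.
have [y' [z' det]] := span2_complement u_neq0.
set x := y' *: a + z' *: b.
have ux_in : in_surface u x by apply: contains_span_comb.
have uxv_free (k l m : K) : k *: u + l *: x + m *: v = 0 -> [/\ k = 0, l = 0 & m = 0].
  move=> comb0.
  have /free4P/(_ (k * y + l * y') (k * z + l * z') (m * p) (m * q)) := free4.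
  case=> [|xa xb xd xe].
    by rewrite -comb0 /u /v /x; apply/rowP => i; rewrite !mxE; ring.
  have kdet : k * (y * z' - z * y') = 0.
    by transitivity (z' * (k * y + l * y') - y' * (k * z + l * z'));
      [ring | rewrite xa xb !mulr0 subrr].
  have ldet : l * (y * z' - z * y') = 0.
    by transitivity (y * (k * z + l * z') - z * (k * y + l * y'));
      [ring | rewrite xa xb !mulr0 subrr].
  have /eqP mv : m *: v = 0 by rewrite /v scalerDr !scalerA xd xe !scale0r addr0.
  move/eqP: kdet; move/eqP: ldet; move: mv.
  rewrite scaler_eq0 !mulf_eq0 (negPf det) (negPf v_neq0) !orbF.
  by move=> /eqP-> /eqP-> /eqP->.
have xuv_free : free [:: x; u; v].
  apply/free3P => k l m comb0; have [] := uxv_free l k m; last by move=> -> -> ->.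
  by rewrite (addrC (l *: u)).
have ux_cover : covered u x.
  move=> i j.
  have -> : i *: u + j *: x = (i * y + j * y') *: a + (i * z + j * z') *: b.
    by rewrite /u /x; apply/rowP => h; rewrite !mxE; ring.
  exact: cover_ab.
by rewrite rE; apply: (transversal_covered xuv_free).
Qed.

End Rational.

(** * Cubic forms as polynomials *)

Definition cubic_mpoly (L : fieldType) (c : 'I_4 -> 'I_4 -> 'I_4 -> L) : {mpoly L[4]} :=
  \sum_i \sum_j \sum_k (c i j k)%:MP * 'X_i * 'X_j * 'X_k.

Lemma mdegS n (m : 'X_{1..n}) d :
  mdeg m = d.+1 -> exists i m', m = (U_(i) + m')%MM /\ mdeg m' = d.
Proof.
move=> deg_m; have [i mi] : exists i, m i != 0%N.
  apply/existsP; apply: contraPT deg_m => /existsPn m0.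
  by rewrite mdegE big1 // => i _; apply/eqP; rewrite -[_ == _]negbK.
have Ui : (U_(i) <= m)%MM by rewrite lep1mP.
exists i, (m - U_(i))%MM; split; first by rewrite addmC submK.
by apply/eqP; rewrite -eqSS -deg_m -{2}(submK Ui) mdegD mdeg1 addn1.
Qed.

Lemma cubic_mpolyP (L : fieldType) (F : {mpoly L[4]}) :
  F \is 3.-homog -> exists c, F = cubic_mpoly c.
Proof.
move=> /dhomogP F3; rewrite (mpolyE F) big_seq.
apply: (big_ind (fun p => exists c, p = cubic_mpoly c)).
- exists (fun _ _ _ => 0); rewrite /cubic_mpoly big1 // => i _; rewrite big1 // => j _.
  by rewrite big1 // => k _; rewrite mpolyC0 !mul0r.
- move=> _ _ [c1 ->] [c2 ->]; exists (fun i j k => c1 i j k + c2 i j k).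
  rewrite /cubic_mpoly -big_split; apply: eq_bigr => i _; rewrite -big_split.
  apply: eq_bigr => j _; rewrite -big_split; apply: eq_bigr => k _ /=.
  by rewrite mpolyCD !mulrDl.
move=> m /F3 /mdegS[i [m1 [-> /mdegS[j [m2 [-> /eqP]]]]]] /mdeg1P[k /eqP->].
exists (fun i' j' k' => F@_(U_(i) + (U_(j) + U_(k)))%MM *
  ((i' == i) && (j' == j) && (k' == k))%:R).
rewrite /cubic_mpoly (bigD1 i) //= (bigD1 j) //= (bigD1 k) //= !eqxx mulr1.
rewrite !big1 ?addr0 => [|i' /negPf->|j' /negPf->|k' /negPf->].
- by rewrite -mul_mpolyC !mpolyXD !mulrA.
- rewrite big1 // => j' _; rewrite big1 // => k' _.
  by rewrite mulr0 mpolyC0 !mul0r.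
- by rewrite big1 // => k' _; rewrite andbF mulr0 mpolyC0 !mul0r.
- by rewrite andbF mulr0 mpolyC0 !mul0r.
Qed.

Section Evaluation.

Variables (L : fieldType) (c : 'I_4 -> 'I_4 -> 'I_4 -> L).

Lemma meval_cubic (v : 'rV[L]_4) : (cubic_mpoly c).@[fun i => v 0 i] = cubic c v.
Proof.
rewrite /cubic_mpoly raddf_sum; apply: eq_bigr => i _.
rewrite raddf_sum; apply: eq_bigr => j _; rewrite raddf_sum; apply: eq_bigr => k _.
by rewrite /= !mevalM mevalC !mevalXU.
Qed.

Lemma meval_mderiv_cubic (v : 'rV[L]_4) i :
  ((cubic_mpoly c)^`M(i)).@[fun j => v 0 j] = grad c v (delta_mx 0 i).
Proof.
rewrite /cubic_mpoly /grad /tri -!big_split /= (raddf_sum (mderiv i)) raddf_sum.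
apply: eq_bigr => j _.
rewrite -!big_split /= (raddf_sum (mderiv i)) raddf_sum; apply: eq_bigr => k _.
rewrite -!big_split /= (raddf_sum (mderiv i)) raddf_sum; apply: eq_bigr => l _ /=.
have dX m : (('X_m)^`M(i)).@[fun j => v 0 j] = (delta_mx 0 i : 'rV[L]_4) 0 m.
  rewrite mderivX mevalZ mxE eqxx mnm1E eq_sym.
  case: eqP => [->|_]; last by rewrite mul0r.
  by rewrite -{1}[U_(m)%MM]add0m addmK mpolyX0 meval1 mulr1.
by rewrite !mderivM mderivC !(mevalD, mevalM) !dX meval0 !mevalC !mevalXU; ring.
Qed.

Lemma param_polyE (x y : 'rV[L]_4) :
  param_poly (cubic_mpoly c) x y =
  (cubic c x)%:P + (grad c x y)%:P * 'X + (grad c y x)%:P * 'X ^+ 2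
  + (cubic c y)%:P * 'X ^+ 3.
Proof.
rewrite /param_poly /cubic_mpoly raddf_sum.
have polyC_tri u v w : (tri c u v w)%:P =
  \sum_i \sum_j \sum_k (c i j k)%:P * (u 0 i)%:P * (v 0 j)%:P * (w 0 k)%:P.
  rewrite /tri raddf_sum; apply: eq_bigr => i _; rewrite raddf_sum.
  by apply: eq_bigr => j _; rewrite raddf_sum; apply: eq_bigr => k _; rewrite /= !polyCM.
rewrite /cubic /grad !polyCD !polyC_tri !(mulrDl, mulr_suml) -!big_split /=.
apply: eq_bigr => i _; rewrite raddf_sum !(mulrDl, mulr_suml) -!big_split /=.
apply: eq_bigr => j _; rewrite raddf_sum !(mulrDl, mulr_suml) -!big_split /=.
apply: eq_bigr => k _ /=; rewrite !rmorphM /= mmapC !mmapX !mmap1U; ring.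
Qed.

End Evaluation.

(** * Smoothness and the intersection of the surface with a line *)

Lemma binary_quadratic_root (L : closedFieldType) (p q r : L) :
  exists x y, ((x != 0) || (y != 0)) /\ p * x ^+ 2 + q * x * y + r * y ^+ 2 = 0.
Proof.
have [->|p_neq0] := eqVneq p 0; first by exists 1, 0; split; [rewrite oner_neq0|ring].
have /closed_rootP[x /rootP] : size (Poly [:: r; q; p]) != 1.
  rewrite (@PolyK _ 0) //=.
rewrite horner_Poly /= => root_x; exists x, 1.
by split; [rewrite oner_neq0 orbT | rewrite -[RHS]root_x; ring].
Qed.

(** Suppose the plane abn is tangent along the line ab. Then the gradient at a
    point x a + y b is determined by its value on one vector m outside the plane,
    and this value is a binary quadratic form in x, y. At a zero of this form the
    surface is singular. *)
Lemma smooth_not_tangent_along_line (L : closedFieldType) c (a b n : 'rV[L]_4) :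
  smooth_form c ->
  free [:: n; a; b] -> contains_span c a b ->
  ~ [/\ grad c a n = 0, grad c b n = 0 & polar c a b n = 0].
Proof.
move=> smooth nab_free [fa fb ab ba] [an bn abn].
have a_neq0 : a != 0 by apply: (free_not0 nab_free); rewrite !inE eqxx orbT.
have aa : grad c a a = 0 by rewrite grad_diag fa mulr0.
have [m [am mnab_free]] := exists_off_tangent_plane smooth nab_free a_neq0 fa an aa ab.
have [x [y [xy_neq0 root_xy]]] :=
  binary_quadratic_root (grad c a m) (polar c a b m) (grad c b m).
have [||w /eqP[]] := smooth (x *: a + y *: b).
- apply: contraL xy_neq0 => /eqP v0; rewrite negb_or !negbK.
  move: nab_free; rewrite free_cons => /andP[_ /free2P/(_ _ _ v0)[-> ->]].
  by rewrite eqxx.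
- by rewrite !polarE fa fb ab ba; ring.
have [x1 [x2 [x3 [x4 ->]]]] := basis4_decomp w mnab_free.
rewrite !polarE fa fb ab ba an bn abn.
apply: etrans (etrans (congr1 ( *%R x1) root_xy) (mulr0 x1)); ring.
Qed.

(** A nonzero linear form p x + q y on the line uv vanishes only at the point
    q u - p v. *)
Lemma root_linear_form (L : fieldType) (u v : 'rV[L]_4) p q x y :
  free [:: u; v] -> (p != 0) || (q != 0) -> x *: u + y *: v != 0 ->
  (p * x + q * y == 0) = (<[x *: u + y *: v]>%VS == <[q *: u + (- p) *: v]>%VS).
Proof.
move=> uv_free pq_neq0 xy_neq0; apply/eqP/eqP => [root_xy|].
  have [k [xk yk]] : exists k, x = k * q /\ y = k * - p.
    have [p0|p_neq0] := eqVneq p 0.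
      move: pq_neq0 root_xy; rewrite p0 eqxx mul0r add0r => /= q_neq0 /eqP.
      rewrite mulf_eq0 (negPf q_neq0) => /eqP->; exists (x / q).
      by rewrite divfK // oppr0 mulr0.
    exists (- (y / p)); rewrite mulrNN divfK //; split=> //.
    apply: (mulfI p_neq0); rewrite -[LHS](addrK (q * y)) root_xy; field; exact: p_neq0.
  move: xy_neq0; rewrite xk yk -!scalerA -scalerDr scaler_eq0 negb_or => /andP[k_neq0 _].
  by rewrite vlineZ.
move=> line_eq; have : x *: u + y *: v \in <[q *: u + (- p) *: v]>%VS.
  by rewrite -line_eq memv_line.
case/vlineP=> k /eqP; rewrite -subr_eq0 => /eqP xy_eq.
have /free2P/(_ (x - k * q) (y + k * p))[] := uv_free.
  by rewrite -xy_eq; apply/rowP => i; rewrite !mxE; ring.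
by move=> /eqP; rewrite subr_eq0 => /eqP-> /eqP; rewrite addr_eq0 => /eqP->; ring.
Qed.

Lemma mup_linear (L : fieldType) (p q : L) : (p != 0) || (q != 0) ->
  p%:P + q%:P * 'X != 0 /\ mup 0 (p%:P + q%:P * 'X) = (p == 0).
Proof.
move=> pq_neq0; have [p0|p_neq0] := eqVneq p 0; last first.
  have pNroot : ~~ root (p%:P + q%:P * 'X) 0 by rewrite /root !hornerE.
  by split; [apply: contra pNroot => /eqP->; rewrite root0 | apply: mupNroot].
rewrite p0 eqxx in pq_neq0 *; rewrite add0r -['X]expr1 -[X in X ^+ 1]subr0.
rewrite mupMr ?rootC // mup_XsubCX eqxx; split=> //.
by rewrite mulf_neq0 ?polyC_eq0 // expr1 polyXsubC_eq0.
Qed.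

(** On the line uv the cubic form is the product of three linear forms, one for
    each of the points; the multiplicity of X counts those that vanish at X. *)
Lemma chord_int_mult (L : fieldType) c (u v : 'rV[L]_4) (X : {vspace 'rV[L]_4}) :
  free [:: u; v] -> cubic c u = 0 -> cubic c v = 0 ->
  (grad c u v != 0) || (grad c v u != 0) -> is_point X ->
  int_mult (cubic_mpoly c) <<[:: u; v]>>%VS X =
    ((X == <[u]>%VS) + (X == <[v]>%VS) +
     (X == <[grad c v u *: u + (- grad c u v) *: v]>%VS))%N.
Proof.
set p := grad c u v; set q := grad c v u.
move=> uv_free fu fv pq_neq0 X_pt; rewrite /int_mult; case: ifPn => [Xl|XNl]; last first.
  have XN z : z \in <<[:: u; v]>>%VS -> (X == <[z]>%VS) = false.
    by move=> z_l; apply: contraNF XNl => /eqP->; rewrite -memvE.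
  rewrite !XN //; apply/mem_span2; [by exists q, (- p)|exists 0, 1|exists 1, 0].
    by rewrite scale0r add0r scale1r.
  by rewrite scale0r addr0 scale1r.
have [x_neq0 XE] := vpick_point X_pt; set x := vpick X in x_neq0 XE *.
set l := <<_>>%VS in Xl *; have [y_l yNX] := vpick_diff (uv_free : is_line l) X_pt Xl.
set y := vpick _ in y_l yNX *.
have y_neq0 : y != 0 by apply: contraNneq yNX => ->; apply: mem0v.
have x_l : x \in l by apply: (subvP Xl); apply: memv_pick.
have /mem_span2[x1 [x2 xE]] := x_l; have /mem_span2[y1 [y2 yE]] := y_l.
have det : x1 * y2 - x2 * y1 != 0.
  apply: contra yNX => det0; rewrite XE.
  have := @root_linear_form _ u v (- y2) y1 x1 x2 uv_free.
  rewrite opprK -xE -yE => /(_ _ x_neq0) lines_eq.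
  suff -> : <[x]>%VS = <[y]>%VS by apply: memv_line.
  apply/eqP; rewrite -lines_eq.
    by rewrite -oppr_eq0 -[X in X == _](_ : x1 * y2 - x2 * y1 = _) //; ring.
  rewrite oppr_eq0 -negb_and; apply: contra y_neq0 => /andP[/eqP y20 /eqP y10].
  by rewrite yE y10 y20 !scale0r addr0.
have form_neq0 s t : (s != 0) || (t != 0) ->
    (s * x1 + t * x2 != 0) || (s * y1 + t * y2 != 0).
  apply: contraLR; rewrite !negb_or !negbK => /andP[/eqP sx /eqP sy].
  have /eqP : s * (x1 * y2 - x2 * y1) = 0.
    by apply: etrans (_ : y2 * (s * x1 + t * x2) - x2 * (s * y1 + t * y2) = 0);
      [ring | rewrite sx sy; ring].
  have /eqP : t * (x1 * y2 - x2 * y1) = 0.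
    by apply: etrans (_ : x1 * (s * y1 + t * y2) - y1 * (s * x1 + t * x2) = 0);
      [ring | rewrite sx sy; ring].
  by rewrite !mulf_eq0 (negPf det) !orbF => -> ->.
have -> : param_poly (cubic_mpoly c) x y =
    ((0 * x1 + 1 * x2)%:P + (0 * y1 + 1 * y2)%:P * 'X) *
    (((1 * x1 + 0 * x2)%:P + (1 * y1 + 0 * y2)%:P * 'X) *
     ((p * x1 + q * x2)%:P + (p * y1 + q * y2)%:P * 'X)).
  rewrite param_polyE xE yE !polarE fu fv -/p -/q; ring.
have form01 : (0 != 0 :> L) || (1 != 0 :> L) by rewrite oner_neq0 orbT.
have form10 : (1 != 0 :> L) || (0 != 0 :> L) by rewrite oner_neq0.
have [nz1 m1] := mup_linear (form_neq0 _ _ form01).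
have [nz2 m2] := mup_linear (form_neq0 _ _ form10).
have [nz3 m3] := mup_linear (form_neq0 _ _ pq_neq0).
rewrite !mupM ?mulf_neq0 // {}m1 {}m2 {}m3 {nz1 nz2 nz3} XE.
have line_eq s t := @root_linear_form _ u v s t x1 x2 uv_free.
rewrite -xE in line_eq; rewrite !line_eq // addnA scale1r oppr0 scale0r addr0.
rewrite scale0r add0r; congr (_ + (_ == _) + _)%N.
by rewrite vlineZ // oppr_eq0 oner_neq0.
Qed.

(** * Extension of scalars to the algebraic closure *)

(** Brings freeness under the theory of matrix rank, where invariance under
    extension of the field is available. *)
Lemma free_row_free (L : fieldType) m n (X : n.-tuple 'rV[L]_m) :
  free X = row_free (\matrix_(i < n) X`_i).
Proof.
have combE (r : 'rV[L]_n) : r *m \matrix_(i < n) X`_i = \sum_i r 0 i *: X`_i.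
  by rewrite mulmx_sum_row; apply: eq_bigr => i _; rewrite rowK.
apply/freeP/idP => [X_free|X_free k comb0 i].
  apply: inj_row_free => r; rewrite combE => /X_free r0.
  by apply/rowP => i; rewrite r0 mxE.
have /rowP/(_ i) : \row_j k j = 0 :> 'rV_n; last by rewrite !mxE.
apply: (row_free_inj X_free); rewrite mul0mx combE -[RHS]comb0.
by apply: eq_bigr => j _; rewrite mxE.
Qed.

Section BaseChange.

Variables (K : fieldType) (Kbar : closedFieldType) (iota : {rmorphism K -> Kbar}).
Variable c : 'I_4 -> 'I_4 -> 'I_4 -> K.
Local Notation F := (cubic_mpoly c).
Local Notation cbar := (fun i j k => iota (c i j k)).
Local Notation map := (map_mx iota).

Lemma tri_map (u v w : 'rV[K]_4) :
  tri cbar (map u) (map v) (map w) = iota (tri c u v w).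
Proof.
rewrite /tri rmorph_sum; apply: eq_bigr => i _; rewrite rmorph_sum.
apply: eq_bigr => j _; rewrite rmorph_sum; apply: eq_bigr => k _.
by rewrite !mxE !rmorphM.
Qed.

Lemma cubic_map v : cubic cbar (map v) = iota (cubic c v).
Proof. exact: tri_map. Qed.

Lemma grad_map u v : grad cbar (map u) (map v) = iota (grad c u v).
Proof. by rewrite /grad !tri_map !rmorphD. Qed.

Lemma polar_map u v w : polar cbar (map u) (map v) (map w) = iota (polar c u v w).
Proof. by rewrite /polar !tri_map !rmorphD. Qed.

Lemma geom_cubic : geom iota F = cubic_mpoly cbar.
Proof.
rewrite /geom /cubic_mpoly rmorph_sum; apply: eq_bigr => i _.
rewrite rmorph_sum; apply: eq_bigr => j _; rewrite rmorph_sum; apply: eq_bigr => k _ /=.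
by rewrite !rmorphM /= !map_mpolyX map_mpolyC.
Qed.

Lemma map_free (X : seq 'rV[K]_4) : free X -> free [seq map v | v <- X].
Proof.
move=> X_free; rewrite -[X]in_tupleE -[[seq _ | _ <- _]]/(tval (map_tuple _ (in_tuple X))).
rewrite free_row_free.
have -> : \matrix_(i < size X) (map_tuple map (in_tuple X))`_i =
    map (\matrix_(i < size X) (in_tuple X)`_i).
  by apply/matrixP => i j; rewrite !mxE /= (nth_map 0) // mxE.
by rewrite row_free_map -free_row_free in_tupleE.
Qed.

Lemma mem_base_change (U : {vspace 'rV[K]_4}) v : v \in U -> map v \in base_change iota U.
Proof.
move=> /coord_vbasis->; rewrite raddf_sum memv_suml //= => i _.
by rewrite matrix.map_mxZ memvZ // memv_span // map_f // mem_nth ?size_tuple ?ltn_ord.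
Qed.

Lemma base_change_span (X : seq 'rV[K]_4) :
  base_change iota <<X>>%VS = <<[seq map v | v <- X]>>%VS.
Proof.
apply/eqP; rewrite eqEsubv; apply/andP; split; apply/span_subvP => _ /mapP[v vX ->].
  have := vbasis_mem vX; rewrite -[X]in_tupleE => /coord_span->.
  rewrite raddf_sum memv_suml //= => i _; rewrite matrix.map_mxZ memvZ // memv_span //.
  by apply: map_f; rewrite mem_nth.
by apply: mem_base_change; apply: memv_span.
Qed.

Lemma base_change_line v : base_change iota <[v]>%VS = <[map v]>%VS.
Proof. by rewrite -!span_seq1 base_change_span. Qed.

(** On the line ab the form takes the values of a polynomial, and a polynomial
    vanishing on an algebraically closed field is zero. *)
Lemma line_in_surface_contains_span a b :
  line_in_surface iota F <<[:: a; b]>>%VS -> contains_span c a b.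
Proof.
rewrite /line_in_surface base_change_span geom_cubic => l_in_S.
have on_line x y : cubic cbar (x *: map a + y *: map b) = 0.
  by rewrite -meval_cubic; apply: l_in_S; apply/mem_span2; exists x, y.
have fa : cubic c a = 0.
  apply: (fmorph_inj iota); rewrite rmorph0 -cubic_map -[RHS](on_line 1 0).
  by rewrite scale1r scale0r addr0.
have fb : cubic c b = 0.
  apply: (fmorph_inj iota); rewrite rmorph0 -cubic_map -[RHS](on_line 0 1).
  by rewrite scale1r scale0r add0r.
pose p := Poly [:: 0; iota (grad c a b); iota (grad c b a)].
have p0 : p = 0.
  apply/eqP; apply/negP => /negP/closed_nonrootP[t /negP[]].
  rewrite /root horner_Poly /=; apply/eqP; rewrite -[RHS](on_line 1 t).
  by rewrite !polarE !grad_map !cubic_map fa fb rmorph0; ring.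
have coef_p i : [:: 0; iota (grad c a b); iota (grad c b a)]`_i = 0.
  by rewrite -coef_Poly -/p p0 coef0.
split=> //; apply: (fmorph_inj iota); rewrite rmorph0.
  exact: coef_p 1.
exact: coef_p 2.
Qed.

(** On proportional u and v the gradient is a multiple of f v. *)
Lemma chord_free (u v : 'rV[K]_4) : v != 0 -> cubic c v = 0 ->
  (grad c u v != 0) || (grad c v u != 0) -> free [:: u; v].
Proof.
move=> v_neq0 fv; rewrite free_cons seq1_free v_neq0 andbT span_seq1.
by apply: contraL => /vlineP[k ->]; rewrite !polarE fv !mulr0 eqxx.
Qed.

Lemma chord_intersection (u v : 'rV[K]_4) :
  v != 0 -> cubic c u = 0 -> cubic c v = 0 ->
  (grad c u v != 0) || (grad c v u != 0) ->
  [/\ is_line <<[:: u; v]>>%VS, ~ line_in_surface iota F <<[:: u; v]>>%VS &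
    intersection_is iota F <<[:: u; v]>>%VS <[u]>%VS <[v]>%VS
      <[grad c v u *: u + (- grad c u v) *: v]>%VS].
Proof.
move=> v_neq0 fu fv uv_neq0; have uv_free := chord_free v_neq0 fv uv_neq0.
split; first exact: uv_free.
  case/line_in_surface_contains_span=> _ _ uv vu.
  by rewrite uv vu eqxx in uv_neq0.
move=> X X_point; rewrite geom_cubic base_change_span !base_change_line.
rewrite chord_int_mult ?map_free // ?cubic_map ?grad_map ?fmorph_eq0 ?fu ?fv ?rmorph0 //.
  by rewrite map_mxD !matrix.map_mxZ rmorphN.
exact: (map_free uv_free).
Qed.

Hypothesis F_smooth : smooth_cubic_surface iota F.

Lemma smooth_bar : smooth_form cbar.
Proof.
case: F_smooth => _ _ smooth v v_neq0; rewrite -meval_cubic -geom_cubic.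
case/(smooth v v_neq0) => i; rewrite geom_cubic meval_mderiv_cubic => vi.
by exists (delta_mx 0 i).
Qed.

Lemma smooth_rational : smooth_form c.
Proof.
move=> v v_neq0 fv; case: F_smooth => _ _ /(_ (map v)) smooth.
have [||i] := smooth; first by rewrite map_mx_eq0.
  by rewrite geom_cubic meval_cubic cubic_map fv rmorph0.
rewrite geom_cubic meval_mderiv_cubic -(map_delta_mx iota) grad_map fmorph_eq0 => vi.
by exists (delta_mx 0 i).
Qed.

Lemma contains_span_map a b : contains_span c a b -> contains_span cbar (map a) (map b).
Proof. by case=> fa fb ab ba; split; rewrite ?cubic_map ?grad_map ?fa ?fb ?ab ?ba rmorph0. Qed.

Lemma rational_not_tangent_along_line a b n : free [:: n; a; b] ->
  contains_span c a b -> ~ [/\ grad c a n = 0, grad c b n = 0 & polar c a b n = 0].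
Proof.
move=> nab_free ab_in [an bn abn].
have := @smooth_not_tangent_along_line Kbar cbar (map a) (map b) (map n) smooth_bar.
move=> /(_ (map_free nab_free) (contains_span_map ab_in)); apply.
by rewrite !grad_map polar_map an bn abn rmorph0.
Qed.

(** If the conic residual to ab in the tangent plane at a were singular at a, it
    would split over the algebraic closure into two lines through a. They differ
    from ab and from each other, as otherwise the plane would be tangent along
    one of these lines; so a would be an Eckardt point. *)
Lemma non_eckardt_smooth_at a b n : free [:: n; a; b] -> contains_span c a b ->
  grad c a n = 0 -> ~ eckardt_point iota F <[a]>%VS ->
  (grad c n a != 0) || (polar c a b n != 0).
Proof.
move=> nab_free ab_in an; apply: contra_notT; rewrite negb_or !negbK.
case/andP=> /eqP na /eqP abn.
have [fa fb ab ba] := contains_span_map ab_in.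
set a' := map a in fa ab ba; set b' := map b in fb ab ba; set n' := map n.
have an' : grad cbar a' n' = 0 by rewrite grad_map an rmorph0.
have na' : grad cbar n' a' = 0 by rewrite grad_map na rmorph0.
have abn' : polar cbar a' b' n' = 0 by rewrite polar_map abn rmorph0.
have n'_free : free [:: n'; a'; b'] by apply: (map_free nab_free).
set q := grad cbar b' n'.
have q_neq0 : q != 0.
  apply/eqP => q0.
  exact: (smooth_not_tangent_along_line smooth_bar n'_free (contains_span_map ab_in)).
(* The conic is q (z - r1 x)(z - r2 x) in the coordinates of x n + y a + z b. *)
have [r1 [r2 split_conic]] : exists r1 r2,
    grad cbar n' b' = - q * (r1 + r2) /\ cubic cbar n' = q * (r1 * r2).
  have /closed_rootP[r1 /rootP] : size (Poly [:: cubic cbar n'; grad cbar n' b'; q]) != 1.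
    by rewrite (@PolyK _ 0).
  rewrite horner_Poly /= => root_r1; exists r1, (- (grad cbar n' b' / q) - r1).
  split; first by field.
  by rewrite -[LHS]addr0 -[X in _ + X]oppr0 -[X in _ - X]root_r1; field.
have [r_sum r_prod] := split_conic.
have root_line r : (r - r1) * (r - r2) = 0 -> contains_span cbar a' (n' + r *: b').
  move=> root_r; split=> //; rewrite !polarE ?(polar_perm cbar a' b' n').
  - rewrite fb r_sum r_prod -/q.
    apply: etrans (etrans (congr1 ( *%R q) root_r) (mulr0 q)); ring.
  - by rewrite an' ab; ring.
  by rewrite na' ba abn'; ring.
have line1 := root_line r1; have line2 := root_line r2.
rewrite subrr mul0r in line1; rewrite subrr mulr0 in line2.
have r12 : r1 != r2.
  apply/eqP => r12; apply: (smooth_not_tangent_along_line smooth_bar _ (line1 erefl)).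
    2: split; first exact: ab.
  - apply/free3P => x y z comb0; move/free3P: n'_free => /(_ z y (x + z * r1)) [].
      by rewrite -comb0; apply/rowP => i; rewrite !mxE; ring.
    by move=> -> -> ; rewrite mul0r addr0.
  - by rewrite !polarE r_sum -r12 fb -/q; ring.
  by rewrite !polarE !(polar_perm cbar a' b' n') abn' ba; ring.
have notin_l r : n' + r *: b' \notin <<[:: a'; b']>>%VS.
  apply: contraL n'_free => /mem_span2[x [y nE]]; rewrite free_cons negb_and negbK.
  by apply/orP; left; apply/mem_span2; exists x, (y - r); rewrite scalerBl addrA -nE addrK.
have lines_neq : <<[:: a'; (n' + r1 *: b')%R]>>%VS != <<[:: a'; (n' + r2 *: b')%R]>>%VS.
  apply: contra r12 => /eqP lines_eq.
  have : n' + r1 *: b' \in <<[:: a'; (n' + r2 *: b')%R]>>%VS.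
    by rewrite -lines_eq memv_span // !inE eqxx orbT.
  case/mem_span2=> x [y nE]; move/free3P: n'_free => /(_ (y - 1) x (y * r2 - r1)) [].
    have -> : (y - 1) *: n' + x *: a' + (y * r2 - r1) *: b' =
        x *: a' + y *: (n' + r2 *: b') - (n' + r1 *: b').
      by apply/rowP => i; rewrite !mxE; ring.
    by rewrite -nE subrr.
  move=> /eqP; rewrite subr_eq0 => /eqP-> _ /eqP.
  by rewrite mul1r subr_eq0 eq_sym.
have l_neq r : <<[:: a'; b']>>%VS != <<[:: a'; (n' + r *: b')%R]>>%VS.
  apply: contra (notin_l r) => /eqP->.
  by rewrite memv_span // !inE eqxx orbT.
have line_vanishes b1 : contains_span cbar a' b1 ->
    vanishes_on (geom iota F) <<[:: a'; b1]>>%VS.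
  move=> ab1_in _ /mem_span2[x [y ->]].
  by rewrite geom_cubic meval_cubic contains_span_cubic.
have a_free r : free [:: a'; n' + r *: b'].
  apply/free2P => x y comb0; move/free3P: n'_free => /(_ y x (y * r)) [] //.
  by rewrite -comb0; apply/rowP => i; rewrite !mxE; ring.
have ab_free : free [:: a'; b'] by move: n'_free; rewrite free_cons => /andP[].
exists <<[:: a'; b']>>%VS, <<[:: a'; (n' + r1 *: b')%R]>>%VS, <<[:: a'; (n' + r2 *: b')%R]>>%VS.
split.
- by rewrite /= !inE negb_or !l_neq lines_neq.
- by rewrite /= /is_line -!/(free _) ab_free !a_free.
- by rewrite /= base_change_line -!memvE !memv_span // !inE eqxx.
move=> m; rewrite !inE => /or3P[] /eqP->; apply: line_vanishes; first exact: contains_span_map.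
  exact: line1.
exact: line2.
Qed.

End BaseChange.

(** * The span of a set of points *)

Section Span.

Variables (K : fieldType) (Kbar : closedFieldType) (iota : {rmorphism K -> Kbar}).
Variable c : 'I_4 -> 'I_4 -> 'I_4 -> K.
Local Notation F := (cubic_mpoly c).
Variable B : {vspace 'rV[K]_4} -> Prop.
Hypothesis B_rational : forall R, B R -> rational_point F R.

Lemma rational_pointE v : v != 0 -> rational_point F <[v]>%VS <-> cubic c v = 0.
Proof.
move=> v_neq0; split=> [[_ Fv]|fv].
  by rewrite -meval_cubic; apply: Fv; apply: memv_line.
split; first by rewrite /is_point dim_vline v_neq0.
by move=> _ /vlineP[k ->]; rewrite meval_cubic cubicZ fv mulr0.
Qed.

Lemma span_step_rational n R : span_step iota F B n R -> rational_point F R.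
Proof. by case: n => [/B_rational|n []]. Qed.

Lemma span_step_mono n m R : (n <= m)%N ->
  span_step iota F B n R -> span_step iota F B m R.
Proof.
move=> /subnK<-; elim: (m - n)%N => //= k IHk /IHk Rk.
by split; [apply: span_step_rational Rk | left].
Qed.

Lemma Span_third_point l P Q R : is_line l -> ~ line_in_surface iota F l ->
  intersection_is iota F l P Q R -> rational_point F R ->
  Span iota F B P -> Span iota F B Q -> Span iota F B R.
Proof.
move=> l_line lNS lS_PQR R_pt [m Pm] [n Qn]; exists (maxn m n).+1; split=> //.
right; exists l; split=> //; exists P, Q; split=> //.
  by apply: span_step_mono Pm; rewrite leq_maxl.
by apply: span_step_mono Qn; rewrite leq_maxr.
Qed.

Definition spanned v := v != 0 /\ Span iota F B <[v]>%VS.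

Lemma spanned_cubic v : spanned v -> cubic c v = 0.
Proof.
by case=> v_neq0 [n /span_step_rational]; rewrite rational_pointE.
Qed.

Lemma spanned_scale k v : k != 0 -> spanned v -> spanned (k *: v).
Proof.
by move=> k_neq0 [v_neq0 v_span]; split; rewrite ?vlineZ // scaler_eq0 negb_or k_neq0.
Qed.

Lemma spanned_secant u v : spanned u -> spanned v ->
  (grad c u v != 0) || (grad c v u != 0) ->
  spanned (grad c v u *: u + (- grad c u v) *: v).
Proof.
move=> Su Sv uv_neq0; have [fu fv] := (spanned_cubic Su, spanned_cubic Sv).
have [[u_neq0 u_span] [v_neq0 v_span]] := (Su, Sv).
have [l_line lNS lS] := chord_intersection iota v_neq0 fu fv uv_neq0.
have w_neq0 : grad c v u *: u + (- grad c u v) *: v != 0.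
  apply/eqP => w0; have /free2P/(_ _ _ w0)[vu /eqP] := chord_free v_neq0 fv uv_neq0.
  by rewrite oppr_eq0 => /eqP uv; rewrite uv vu eqxx in uv_neq0.
split=> //; apply: (Span_third_point l_line lNS lS) => //.
by apply/rational_pointE => //; apply: third_point.
Qed.

Lemma spanned_tangent u v : spanned u -> cubic c v = 0 -> grad c u v = 0 ->
  grad c v u != 0 -> spanned v.
Proof.
move=> Su fv uv vu; have fu := spanned_cubic Su; have [u_neq0 u_span] := Su.
have v_neq0 : v != 0.
  by apply: contraNneq vu => ->; rewrite -(scale0r 0) gradZl expr0n mul0r.
have uv_neq0 : (grad c u v != 0) || (grad c v u != 0) by rewrite vu orbT.
have [l_line lNS] := chord_intersection iota v_neq0 fu fv uv_neq0.
rewrite uv oppr0 scale0r addr0 vlineZ // => lS; split=> //.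
apply: (Span_third_point l_line lNS (P := <[u]>%VS) (Q := <[u]>%VS)) => //.
  by move=> X X_pt; rewrite lS // addnAC.
exact/rational_pointE.
Qed.

End Span.

(** * The theorem *)

Lemma span_of_point (K : fieldType) (Kbar : closedFieldType)
    (iota : {rmorphism K -> Kbar}) (hK : at_least 13 K)
    (F : {mpoly K[4]}) (hS : smooth_cubic_surface iota F)
    (l1 l2 : {vspace 'rV[K]_4}) (hl1 : is_line l1) (hl2 : is_line l2)
    (hl1S : line_in_surface iota F l1) (hl2S : line_in_surface iota F l2)
    (hskew : skew_lines l1 l2)
    (P : {vspace 'rV[K]_4}) (hP : rational_point F P)
    (hPl : (P <= l1)%VS) (hPE : ~ eckardt_point iota F P) R :
  rational_point F R -> Span iota F (fun X => X = P) R.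
Proof.
have [c Fc] : exists c, F = cubic_mpoly c by case: hS => _ /cubic_mpolyP.
subst F; have [] := vpick_point (proj1 hP); move: (vpick P) => p p_neq0 PE; subst P.
have [b [pb_free l1E]] := line_basis hl1 hPl p_neq0; subst l1.
have [d d_neq0 d_l2] : exists2 d, d != 0 & d \in l2.
  by exists (vpick l2); rewrite ?memv_pick // vpick0 -dimv_eq0 (eqP hl2).
have [e [de_free l2E]] := line_basis hl2 d_l2 d_neq0; subst l2.
have pbde_free := skew_free pb_free de_free hskew.
have pb_in := line_in_surface_contains_span hl1S.
have de_in := line_in_surface_contains_span hl2S.
have [fp _ pb _] := pb_in.
have smooth := smooth_rational hS.
have no_tangent := rational_not_tangent_along_line hS.
(* The tangent plane at p meets the second line in n. *)
pose n := grad c p e *: d + (- grad c p d) *: e.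
have pn : grad c p n = 0 by rewrite /n gradDr !gradZr; ring.
have n_neq0 : n != 0.
  apply/eqP => n0; have [w /eqP[]] := smooth p p_neq0 fp.
  have /free2P/(_ _ _ n0)[pe /eqP] := de_free; rewrite oppr_eq0 => /eqP pd.
  have [x [y [z [t ->]]]] := basis4_decomp w pbde_free.
  by rewrite !polarE fp pb pd pe; ring.
have npb_free : free [:: n; p; b].
  apply/free3P => x y z; rewrite -addrA addrC /n scalerDr !scalerA.
  move=> comb0; have /free4P/(_ _ _ _ _ comb0)[-> -> xe xd] := pbde_free; split=> //.
  have /eqP : x *: n = 0 by rewrite /n scalerDr !scalerA xe xd !scale0r addr0.
  by rewrite scaler_eq0 (negPf n_neq0) orbF => /eqP.
have smooth_p := non_eckardt_smooth_at hS npb_free pb_in pn hPE.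
pose S := spanned iota c (fun X => X = <[p]>%VS).
have B_rat X : X = <[p]>%VS -> rational_point (cubic_mpoly c) X by move=> ->.
have S_cubic v : S v -> cubic c v = 0 by apply: spanned_cubic.
have S_scale k v : k != 0 -> S v -> S (k *: v) by apply: spanned_scale.
have S_secant := @spanned_secant _ _ iota _ _ B_rat.
have S_tangent := @spanned_tangent _ _ iota _ _ B_rat.
have Sp : S p by split=> //; exists 0.
move=> R_rat; have [] := vpick_point (proj1 R_rat); move: (vpick R) => r r_neq0 RE; subst R.
have fr : cubic c r = 0 by apply/(rational_pointE _ r_neq0).
suff [] : S r by [].
have cover1 := line_covered hK smooth no_tangent S_cubic S_scale S_secant S_tangent
  npb_free pb_in pn smooth_p Sp.
have good := smooth_conic_exists hK smooth no_tangent npb_free pb_in pn smooth_p.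
have cover2 := skew_line_covered hK smooth no_tangent S_cubic S_scale S_secant S_tangent
  pbde_free pb_in de_in good cover1.
exact: (surface_covered hK smooth no_tangent S_cubic S_scale S_secant S_tangent
  pbde_free pb_in de_in cover1 cover2).
Qed.

Theorem theorem1 (K : fieldType) (Kbar : closedFieldType)
    (iota : {rmorphism K -> Kbar}) (hKbar : is_algebraic_closure iota)
    (hK : at_least 13 K)
    (F : {mpoly K[4]}) (hS : smooth_cubic_surface iota F)
    (l1 l2 : {vspace 'rV[K]_4}) (hl1 : is_line l1) (hl2 : is_line l2)
    (hl1S : line_in_surface iota F l1) (hl2S : line_in_surface iota F l2)
    (hskew : skew_lines l1 l2)
    (P : {vspace 'rV[K]_4}) (hP : rational_point F P)
    (hPl : (P <= l1)%VS \/ (P <= l2)%VS)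
    (hPE : ~ eckardt_point iota F P) :
  forall R : {vspace 'rV[K]_4},
    Span iota F (fun X => X = P) R <-> rational_point F R.
Proof.
move=> R; split=> [[n] | R_rat].
  have [c Fc] : exists c, F = cubic_mpoly c by case: hS => _ /cubic_mpolyP.
  by move: hP; rewrite Fc => P_rat; apply: span_step_rational => _ ->.
case: hPl => hPl; last rewrite /skew_lines capvC in hskew.
  exact: (span_of_point hK hS hl1 hl2 hl1S hl2S hskew).
exact: (span_of_point hK hS hl2 hl1 hl2S hl1S hskew).
Qed.
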